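(* Let $F_0$ be a distribution on $\mathbb{R}_+$ with density $f_0$ and mean $1$, let $F$, $\eta$ and $G$ be the associated age distribution, hazard rate and observed hazard rate distribution. For each $N$, let $\lambda_1^{(N)}\ge\dots\ge\lambda_N^{(N)}>0$ and let $\Phi_1,\dots,\Phi_N$ be independent stationary renewal processes such that $\Phi_i$ has inter-arrival distribution $F_0^{(i)}(t)=F_0(\lambda_i^{(N)}t)$. Assume that the distributions $L_N(\lambda):=\frac1N\sum_{i=1}^N\mathbf{1}_{\{\lambda_i^{(N)}\le\lambda\}}$ converge weakly, as $N\to\infty$, to a fixed probability distribution $L$ with no atom at $\lambda=0$. Let $X_i^{(N)}$ be the observed hazard rate of $\Phi_i$ at time $0$ in the $N$-th system, and $\widehat{G}_N(x)=\frac1N\sum_{i=1}^N\mathbf{1}_{\{X_i^{(N)}\le x\}}$. Then, $P$-almost surely, $$\widehat{G}_N\Longrightarrow G_\infty\quad (N\to\infty),\qquad\text{where}\quad G_\infty(x):=\int_0^\infty G(x/\lambda)\,L(d\lambda).$$ Moreover, assume that the memory sizes $C_N$ (integers, $1\le C_N<N$) satisfy $C_N/N\to c$ with $0<c\le1$. Then, if $1-c$ is a continuity point of the quantile function $Q_\infty=G_\infty^{-1}$, the random threshold $\widehat{\theta}_N:=\widehat{Q}_N(1-C_N/N)$ converges $P$-almost surely to $\theta^*=Q_\infty(1-c)$.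
   Context: $\Rightarrow$ denotes weak convergence of probability distributions. A stationary renewal process is a stationary simple point process whose inter-arrival times are i.i.d. under its Palm probability. The age distribution is $F(t)=\int_0^t(1-F_0(s))\,ds$; the hazard rate is $\eta(t)=f_0(t)/(1-F_0(t))$; $G(x)=\int_{\eta^{-1}([0,x])}F(dt)$ is the distribution of $\eta(A)$ when $A\sim F$. The hazard rate of the $i$-th process is $\eta_i(t)=\lambda_i^{(N)}\eta(\lambda_i^{(N)}t)$. If $\tau_0^{(i)}\le0$ is the last point of $\Phi_i$ at or before time $0$, the observed hazard rate is $X_i^{(N)}=\eta_i(-\tau_0^{(i)})$. For each $N$, the variables $X_1^{(N)},\dots,X_N^{(N)}$ are independent and $X_i^{(N)}$ has distribution function $G(x/\lambda_i^{(N)})$. All variables $\{X_i^{(N)}:1\le i\le N,\ N\ge1\}$ are defined on a common probability space $(\Omega,\mathcal{F},P)$ (a triangular array). Quantile functions: $\widehat{Q}_N(p)=\inf\{x\ge0:\widehat{G}_N(x)\ge p\}$ and $Q_\infty(p)=\inf\{x\ge0:G_\infty(x)\ge p\}$, $p\in[0,1]$. *)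

(* Defs.v *)
From HB Require Import structures.
From mathcomp Require Export all_boot all_order all_algebra.
From mathcomp Require Export all_classical all_reals all_analysis.
From mathcomp Require Export measurable_realfun.
Set Implicit Arguments.
Unset Strict Implicit.
Unset Printing Implicit Defensive.
Import Order.TTheory GRing.Theory Num.Theory.
Import numFieldNormedType.Exports.
Local Open Scope classical_set_scope.
Local Open Scope ring_scope.

Section DistributionFunctions.
Context {R : realType}.

Definition df (mu : probability (measurableTypeR R) R) (x : R) : R :=
  fine (mu `]-oo, x]%classic).

Definition is_df (F : R -> R) : Prop :=
  [/\ {homo F : x y / x <= y}, right_continuous F,
      F x @[x --> -oo] --> (0 : R) & F x @[x --> +oo] --> (1 : R)].

(* Weak convergence of probability distributions on the line, the distributions
   being given by their distribution functions. The limit is required to be a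
   proper distribution function: no mass escapes to infinity. *)
Definition weak_cvg (F_ : nat -> R -> R) (F : R -> R) : Prop :=
  is_df F /\
  forall x, {for x, continuous F} -> F_ N x @[N --> \oo] --> F x.

(* Empirical distribution function of n real numbers. *)
Definition empirical_df (n : nat) (x : 'I_n -> R) (y : R) : R :=
  n%:R^-1 * \sum_(i < n) ((x i <= y)%R : nat)%:R.

(* Extended-real valued, so that the infimum of the empty set is +oo (which can
   only happen for p = 1 when F is a distribution function). *)
Definition quantile (F : R -> R) (p : R) : \bar R :=
  ereal_inf [set x%:E | x in [set x | 0 <= x /\ p <= F x]].

Definition age_df (F0 : probability (measurableTypeR R) R) (t : R) : R :=
  \int[lebesgue_measure]_(s in `[0, t]) (1 - df F0 s).

(* Where df F0 t = 1 the division yields 0; the age distribution gives no mass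
   to such t. *)
Definition hazard (F0 : probability (measurableTypeR R) R) (f0 : R -> R)
  (t : R) : R := f0 t / (1 - df F0 t).

(* G(x): F is the age distribution and eta the hazard rate. *)
Definition hazard_df (F : probability (measurableTypeR R) R) (eta : R -> R)
  (x : R) : R := fine (F (eta @^-1` `[0, x]%classic)).

Definition mixture_df (G : R -> R) (L : probability (measurableTypeR R) R)
  (x : R) : R := \int[L]_(l in `]0, +oo[) G (x / l).

End DistributionFunctions.

Section PointProcesses.
Context {R : realType} {d : measure_display} {T : measurableType d}.
Variable P : probability T R.
Local Open Scope ereal_scope.

(* tau n w is the n-th point of the process, the points being numbered
   increasingly over the integers with tau 0 <= 0 < tau 1. The strict
   monotonicity is simplicity; the two limits are local finiteness and the
   existence of infinitely many points on either side of the origin. *)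
Definition simple_point_process (tau : int -> T -> R) : Prop :=
  (forall n, measurable_fun setT (tau n)) /\
  {ae P, forall w,
    [/\ (tau 0%R w <= 0 < tau 1%R w)%R,
        (forall n : int, (tau n w < tau (n + 1) w)%R),
        tau k%:Z w @[k --> \oo] --> +oo%R &
        tau (- k%:Z)%R w @[k --> \oo] --> -oo%R]}.

Definition count (tau : int -> T -> R) (B : set R) (w : T) : \bar R :=
  \esum_(n in [set: int]) (\1_B (tau n w))%:E.

(* Events depending on the process through finitely many of its counts; they
   generate the sigma-algebra of the process and are stable under finite
   intersections. *)
Definition count_event (tau : int -> T -> R) (m : nat) (B : 'I_m -> set R)
  (C : 'I_m -> set (\bar R)) : set T :=
  [set w | forall j, C j (count tau (B j) w)].

Definition stationary (tau : int -> T -> R) : Prop :=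
  forall (t : R) (m : nat) (B : 'I_m -> set R) (C : 'I_m -> set (\bar R)),
    (forall j, measurable (B j)) -> (forall j, measurable (C j)) ->
    P (count_event tau (fun j => [set (x + t)%R | x in B j]) C) =
    P (count_event tau B C).

Definition independent_processes (n : nat) (tau : 'I_n -> int -> T -> R)
  : Prop :=
  forall (m : nat) (B : 'I_n -> 'I_m -> set R)
         (C : 'I_n -> 'I_m -> set (\bar R)),
    (forall i j, measurable (B i j)) -> (forall i j, measurable (C i j)) ->
    P [set w | forall i, count_event (tau i) (B i) (C i) w] =
    \prod_(i < n) P (count_event (tau i) (B i) (C i)).

Definition intensity (tau : int -> T -> R) : \bar R :=
  \int[P]_w count tau `]0%R, 1%R] w.

(* Palm probability of an event E on the sequence of points:
   E[sum over the points x in ]0, 1] of 1_E(process seen from x)] / intensity.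
   The process seen from its n-th point has points tau (n + k) - tau n, its
   0-th point being the origin. *)
Definition palm (tau : int -> T -> R) (E : set (int -> R)) : \bar R :=
  ((fine (intensity tau))^-1)%:E *
  \int[P]_w \esum_(n in [set: int])
     (\1_(`]0%R, 1%R] : set R) (tau n w) *
      \1_E (fun k : int => tau (n + k)%R w - tau n w))%:E.

Definition interarrival (u : int -> R) (k : int) : R := (u (k + 1) - u k)%R.

(* Stationary renewal process whose inter-arrival distribution has distribution
   function H: under the Palm probability, the inter-arrival times are mutually
   independent and each of them has distribution function H. *)
Definition stationary_renewal (tau : int -> T -> R) (H : R -> R) : Prop :=
  [/\ simple_point_process tau, stationary tau,
      0 < intensity tau < +oo,
      (forall (J : seq int) (B : int -> set R), uniq J ->
         (forall k, measurable (B k)) ->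
         palm tau [set u | forall k, k \in J -> B k (interarrival u k)] =
         \prod_(k <- J) palm tau [set u | B k (interarrival u k)]) &
      (forall (k : int) (x : R),
         palm tau [set u | (interarrival u k <= x)%R] = (H x)%:E)].

End PointProcesses.

(* Observed hazard rate at time 0 of a process with points tau and hazard rate
   t |-> l * eta (l * t). *)
Definition observed_hazard {R : realType} {T : Type} (eta : R -> R) (l : R)
  (tau : int -> T -> R) (w : T) : R := l * eta (l * - tau 0 w).

(* Main.v *)
(* Only the k = 0 marginal of the Palm inter-arrival law is needed. Cutting ]0, 1]
   into K cells and counting the cells that contain a point and are followed by
   an empty interval of length x shows that the void probability v satisfies
     m (1 - H (x + 1/K)) <= K (v x - v (x + 1/K)) <= m (1 - H x),
   m being the intensity and H the inter-arrival distribution function. Summing,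
   v x = 1 - m * (integral of 1 - H over [0, x]), so the scaled age of the i-th
   process at time 0 has distribution F (and m = lambda_i, by letting x go to
   +oo). Since {-tau 0 >= t} is a void event up to a null set, independence of
   the counts gives independence of the ages.

   For fixed x, the indicators of {X_i <= x} are then independent Bernoulli
   variables of parameters G (x / lambda_i); a Chernoff bound and Borel-Cantelli,
   which unlike a subsequence argument do not compare different rows of the
   array, show that the empirical distribution function is almost surely
   asymptotic to the average of the G (x / lambda_i). By Tonelli this average is
   the integral over F(da) of the empirical distribution function of the
   lambda_i eta(a); it tends by dominated convergence to Ginf x when x is not an
   atom of the law of lambda eta(A), lambda ~ L and A ~ F being independent. A
   countable dense set of such x suffices, by monotonicity, for weak convergence
   and for the convergence of quantiles. *)
From HB Require Import structures.
Require Import Defs.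
From mathcomp Require Import ring lra zify.
Set Implicit Arguments.
Unset Strict Implicit.
Unset Printing Implicit Defensive.
Import Order.TTheory GRing.Theory Num.Theory.
Import numFieldNormedType.Exports.
Local Open Scope classical_set_scope.
Local Open Scope ring_scope.

(** * Void probabilities of a stationary renewal process *)

Section MeasurableEsum.
Context {R : realType} {d : measure_display} {T : measurableType d}.
Local Open Scope ereal_scope.

(** The index type is enumerated through [pickle], which turns the sum into a series of nonnegative
    measurable functions. *)
Lemma measurable_fun_esum (I : countType) (a : I -> T -> \bar R) :
  (forall i, measurable_fun setT (a i)) -> (forall i w, 0 <= a i w) ->
  measurable_fun setT (fun w => \esum_(i in [set: I]) a i w).
Proof.
move=> ma a0.
(* [unpickle] may also decode numbers outside the range of [pickle]; those terms are set to 0 so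
   that every index is summed exactly once. *)
pose b j w := if j \in range (@pickle I) then oapp (a ^~ w) 0 (unpickle j) else 0.
have b0 j w : 0 <= b j w.
  by rewrite /b; case: ifP => // _; case: (@unpickle I j) => /=.
apply: (@eq_measurable_fun _ _ _ _ _ (fun w => \sum_(j <oo | j \in xpredT) b j w)).
  move=> w _; rewrite nneseries_esum// (_ : [set x | x \in xpredT] = setT)//; last first.
    by apply/seteqP; split.
  rewrite /b -(esum_mkcond (range (@pickle I)) (fun j => oapp (a ^~ w) 0 (unpickle j))).
  rewrite esum_image; last by move=> x y _ _ /(pcan_inj pickleK).
  by apply: eq_esum => i _; rewrite pickleK.
apply: ge0_emeasurable_sum => // j _.
rewrite /b; case: (j \in range (@pickle I)) => //.
by case: (@unpickle I j).
Qed.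

End MeasurableEsum.

(** * Increasing sequences indexed by the integers and unbounded on both sides *)

Section LocallyFinite.
Context {R : realType}.
Variable t : int -> R.
Hypothesis t_lt : forall n, t n < t (n + 1).

Lemma int_seq_lt m n : (m < n)%R -> t m < t n.
Proof.
move=> mn; have -> : n = m + (`|n - m|%N.-1.+1)%:Z by lia.
elim: (`|n - m|%N.-1) => [|k IH]; first exact: t_lt.
by apply: (lt_trans IH); rewrite -(addn1 k.+1) PoszD addrA; exact: t_lt.
Qed.

Hypothesis t_ub : t k%:Z @[k --> \oo] --> +oo%R.
Hypothesis t_lb : t (- k%:Z)%R @[k --> \oo] --> -oo%R.

Lemma int_seq_last (b : R) : exists n, t n <= b < t (n + 1).
Proof.
have /cvgryPgt/(_ b)[p _ /(_ p (leqnn p)) /= pb] := t_ub.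
have /cvgrNyPle/(_ b)[q _ /(_ q (leqnn q)) /= qb] := t_lb.
(* Since [t (- q) <= b < t p], there is a least number of steps from [- q] leading beyond [b]; the
   wanted index comes just before it. *)
have ex : exists k : nat, b < t (- q%:Z + k%:Z).
  exists (q + p)%N; have -> // : - q%:Z + (q + p)%:Z = p%:Z by lia.
case: (ex_minnP ex) => -[|k] bk kmin.
  by move: bk; rewrite addr0 ltNge qb.
exists (- q%:Z + k%:Z); rewrite -addrA -PoszD addn1 bk andbT leNgt.
by apply/negP => /kmin; rewrite ltnn.
Qed.

End LocallyFinite.

(** * Pathwise comparison of void intervals with gaps between points *)

Section GapCells.
Context {R : realType}.
Variable t : int -> R.
Hypothesis t_lt : forall n, t n < t (n + 1).
Hypothesis t_ub : t k%:Z @[k --> \oo] --> +oo%R.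
Hypothesis t_lb : t (- k%:Z)%R @[k --> \oo] --> -oo%R.

Let t_le m n : (m <= n)%R -> t m <= t n.
Proof. by rewrite le_eqVlt => /predU1P[->//|/(int_seq_lt t_lt)/ltW]. Qed.

Definition void (B : set R) := forall n, ~ B (t n).

(** The witness is the index of the last point at or before [b]. The void condition forces that
    point into the cell, with a gap longer than [x]. Conversely, a point of the cell with a gap
    longer than [x + (b - a)] jumps over [b + x], so it is the last one. A single [n0] serves both
    directions, which lets the indicator be placed at one index of a sum. *)
Lemma last_in_cell (a b x : R) : a <= b -> 0 <= x ->
  exists n0, (void `]b, b + x] /\ ~ void `]a, b + x] ->
                t n0 \in `]a, b] /\ x < t (n0 + 1) - t n0) /\
             (forall n, t n \in `]a, b] -> x + (b - a) < t (n + 1) - t n ->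
                n = n0 /\ (void `]b, b + x] /\ ~ void `]a, b + x])).
Proof.
move=> ab x0; have [n0 /andP[n0b bn0]] := int_seq_last t_ub t_lb b.
exists n0; split=> [[v1 /existsNP[n /contrapT /=]]|n].
  rewrite !in_itv/= => /andP[an nb].
  have tnb : t n <= b.
    by rewrite leNgt; apply/negP => bn; apply: (v1 n); rewrite /= in_itv/= bn.
  have nn0 : (n <= n0)%R.
    rewrite leNgt; apply/negP => n0n.
    have /t_le : (n0 + 1 <= n)%R by lia.
    by rewrite leNgt (le_lt_trans tnb).
  rewrite n0b (lt_le_trans an (t_le nn0)); split=> //.
  have : ~ t (n0 + 1) <= b + x.
    by move=> h; apply: (v1 (n0 + 1)); rewrite /= in_itv/= bn0.
  move=> /negP; rewrite -ltNge; lra.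
rewrite in_itv/= => /andP[an nb] gap.
have bxn : b + x < t (n + 1) by lra.
have nn0 : n = n0.
  apply/eqP; rewrite eq_le; apply/andP; split; rewrite leNgt; apply/negP => h.
    have /t_le : (n0 + 1 <= n)%R by lia.
    by rewrite leNgt (le_lt_trans nb).
  have /t_le : (n + 1 <= n0)%R by lia.
  by rewrite leNgt (le_lt_trans n0b)//; lra.
split => //; split=> [k /=|v].
  rewrite in_itv/= => /andP[bk kbx].
  have /t_le : (n + 1 <= k)%R.
    suff : (n < k)%R by lia.
    rewrite ltNge; apply/negP => /t_le; rewrite leNgt => /negP; apply.
    exact: le_lt_trans bk.
  by rewrite leNgt (le_lt_trans kbx).
apply: (v n); rewrite /= in_itv/= an; lra.
Qed.

Local Open Scope ereal_scope.

Definition points_in (B : set R) : \bar R := \esum_(n in [set: int]) (\1_B (t n))%:E.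

Definition gaps_in (B : set R) (x : R) : \bar R :=
  \esum_(n in [set: int]) (\1_B (t n) * \1_(`]-oo, x]) (t (n + 1)%R - t n))%:E.

Let esum_delta (b : bool) (n0 : int) :
  \esum_(n in [set: int]) (((n == n0) && b)%:R : R)%:E = (b%:R)%:E.
Proof.
transitivity (\esum_(n in [set n0]) ((b%:R : R)%:E)); last first.
  by rewrite esum_set1// lee_fin.
rewrite [RHS]esum_mkcond; apply: eq_esum => n _.
have [->|nn0] := eqVneq n n0; first by rewrite mem_set.
by rewrite memNset//=; exact/eqP.
Qed.

(** By [esum_delta] the indicator [A] is a sum over all indices concentrated at [n0], so both
    inequalities hold term by term. Short gaps are added rather than long gaps counted by
    subtraction, because the sums are extended reals. *)
Lemma gaps_cell (a b x : R) : (a <= b)%R -> (0 <= x)%R ->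
  let A := `[< void `]b, (b + x)%R] /\ ~ void `]a, (b + x)%R] >] in
  ((A%:R : R)%:E + gaps_in `]a, b] x <= points_in `]a, b]) /\
  (points_in `]a, b] <= (A%:R : R)%:E + gaps_in `]a, b] (x + (b - a))%R).
Proof.
move=> ab x0; have [n0 [h1 h2]] := last_in_cell ab x0 => A.
have ge0 B y n : 0 <= (\1_B (t n) * \1_(`]-oo, y]) (t (n + 1)%R - t n))%:E :> \bar R.
  by rewrite lee_fin mulr_ge0.
split; rewrite -(esum_delta A n0) -esumD; try by [move=> *; rewrite ?lee_fin//|].
  apply: le_esum => n _; rewrite -EFinD lee_fin.
  have [/andP[/eqP-> /asboolP /h1[cell gap]]|_] := boolP ((n == n0) && A).
    rewrite !indicE !mem_setE cell mul1r in_itv/= [(_ <= x)%R]leNgt gap/=.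
    by rewrite addr0.
  rewrite add0r !indicE !mem_setE.
  by case: (_ \in _) => /=; case: (_ \in _) => /=; rewrite ?mulr0 ?mulr1 ?mul0r.
apply: le_esum => n _; rewrite -EFinD lee_fin.
rewrite !indicE !mem_setE.
have [cell|] := boolP (t n \in `]a, b]%R); last by rewrite mul0r addr0.
rewrite mul1r in_itv/=.
have [_|gap] := leP (t (n + 1)%R - t n)%R _; first by rewrite lerDr.
have [-> ?] := h2 _ cell gap.
by rewrite eqxx (_ : A = true) ?addr0//; apply/asboolP.
Qed.

Lemma indic_cells (K : nat) (y : R) : (0 < K)%N ->
  (\sum_(j < K) \1_(`](j%:R / K%:R)%R, (j.+1%:R / K%:R)%R]%classic : set R) y)%R
  = \1_(`]0%R, 1%R]%classic : set R) y :> R.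
Proof.
move=> K0.
have Kp : (0 < K%:R :> R)%R by rewrite ltr0n.
have gen k : (\sum_(j < k) \1_(`](j%:R / K%:R)%R, (j.+1%:R / K%:R)%R]%classic : set R) y
    = \1_(`]0%R, (k%:R / K%:R)%R]%classic : set R) y :> R)%R.
  elim: k => [|k IH].
    rewrite big_ord0 mul0r indicE mem_setE in_itv/=.
    by case: (ltP 0%R y) => //= y0; rewrite leNgt y0.
  rewrite big_ord_recr/= IH !indicE !mem_setE !in_itv/=.
  have : (0 <= k%:R / K%:R :> R)%R by rewrite divr_ge0.
  have : (k%:R / K%:R < k.+1%:R / K%:R :> R)%R.
    by rewrite ltr_pM2r ?invr_gt0// ltr_nat.
  move: (k%:R / K%:R)%R (k.+1%:R / K%:R)%R => u v uv u0.
  have [y0|y0] := ltP 0%R y; last first.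
    by rewrite /= add0r ltNge (le_trans y0 u0).
  have [yu|yu] /= := leP y u; first by rewrite (le_trans yu (ltW uv)) addr0.
  by rewrite add0r.
by rewrite gen divff// gt_eqF.
Qed.

End GapCells.

(** * From the Palm inter-arrival law to the increments of the void probability *)

Section PalmInversion.
Context {R : realType} {d : measure_display} {T : measurableType d}.
Variables (P : probability T R) (tau : int -> T -> R) (H : R -> R).
Hypothesis renewal : stationary_renewal P tau H.
Local Open Scope ereal_scope.

Definition void_event (B : set R) : set T := [set w | void (tau ^~ w) B].

Lemma points_in_eq0 (t : int -> R) (B : set R) : points_in t B = 0 <-> void t B.
Proof.
split=> [t0 n Bn|v]; last first.
  by apply: esum1 => n _; rewrite indicE memNset.
have : 1 <= points_in t B.
  apply: esum_ge; exists [set n]; first by split.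
  by rewrite fsbig_set1 indicE mem_set.
by rewrite t0 lee_fin ler10.
Qed.

Lemma void_eventE (B : set R) : void_event B = [set w | count tau B w = 0].
Proof. by apply/seteqP; split=> w /points_in_eq0. Qed.

Let mtau n : measurable_fun setT (tau n).
Proof. by case: renewal => -[]. Qed.

Lemma measurable_count (B : set R) : measurable B ->
  measurable_fun setT (count tau B).
Proof.
move=> mB; apply: measurable_fun_esum => n; last by move=> w; rewrite lee_fin.
apply/measurable_EFinP; exact: (measurableT_comp (measurable_indic _) (mtau n)).
Qed.

Lemma measurable_void (B : set R) : measurable B -> measurable (void_event B).
Proof.
move=> mB; rewrite void_eventE -[X in measurable X]setTI.
exact: (measurable_count mB measurableT (emeasurable_set1 0)).
Qed.

Lemma void_event_shift (t : R) (B : set R) : measurable B ->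
  P (void_event [set (x + t)%R | x in B]) = P (void_event B).
Proof.
case: renewal => _ stat _ _ _ mB.
have := stat t 1%N (fun=> B) (fun=> [set 0]) (fun=> mB) (fun=> emeasurable_set1 0).
rewrite !void_eventE /count_event; congr (P _ = P _); apply/seteqP; split=> w /=.
- by apply; exact: ord0.
- by move=> h _.
- by apply; exact: ord0.
- by move=> h _.
Qed.

Lemma void_event_itv (a x : R) :
  P (void_event `]a, (a + x)%R]) = P (void_event `]0%R, x]).
Proof.
rewrite -[RHS](void_event_shift a)//; congr (P (void_event _)).
apply/seteqP; split=> [y|y [z] /=]; rewrite /= !in_itv/=.
  by move=> /andP[ay yax]; exists (y - a)%R; [rewrite in_itv/=; lra|rewrite subrK].
by move=> /andP[z0 zx] <-; lra.
Qed.

(** Seen from its [n]-th point, the process has 0-th inter-arrival time [tau (n + 1) - tau n], so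
    the integral is the unnormalized Palm probability of a first gap at most [x]. Finiteness and
    positivity of the intensity allow the normalization to be undone. *)
Lemma integral_gaps (x : R) :
  \int[P]_w gaps_in (tau ^~ w) `]0%R, 1%R] x =
  (fine (intensity P tau) * H x)%:E.
Proof.
case: renewal => _ _ /andP[I0 Ioo] _ /(_ 0%R x).
rewrite /palm.
set X := (X in _ * X = _).
have -> : X = \int[P]_w gaps_in (tau ^~ w) `]0%R, 1%R] x.
  apply: eq_integral => w _; apply: eq_esum => n _; congr (_ * _)%:E.
  rewrite !indicE; congr (nat_of_bool _)%:R.
  apply/idP/idP; rewrite !inE/= in_itv/= /interarrival add0r addr0;
  by rewrite opprB addrA subrK.
have c0 : fine (intensity P tau) != 0%R.
  by rewrite gt_eqF// fine_gt0// I0.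
by move=> Hx; rewrite EFinM -Hx muleA -EFinM divff// mul1e.
Qed.

Let ae_points : {ae P, forall w, [/\ (forall n : int, (tau n w < tau (n + 1) w)%R),
  tau k%:Z w @[k --> \oo] --> +oo%R & tau (- k%:Z)%R w @[k --> \oo] --> -oo%R]}.
Proof. by case: renewal => -[_ + _ _ _ _]; apply: filterS => w []. Qed.

Let measurable_points_in B : measurable B ->
  measurable_fun setT (fun w => points_in (tau ^~ w) B).
Proof. exact: measurable_count. Qed.

Let measurable_gaps_in B x : measurable B ->
  measurable_fun setT (fun w => gaps_in (tau ^~ w) B x).
Proof.
move=> mB; apply: measurable_fun_esum => n; last by move=> w; rewrite lee_fin mulr_ge0.
apply/measurable_EFinP; apply: measurable_funM.
  exact: (measurableT_comp (measurable_indic _) (mtau n)).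
by apply: (measurableT_comp (measurable_indic _) (measurable_funB (mtau _) (mtau n))).
Qed.

Definition void_prob (x : R) : R := fine (P (void_event `]0%R, x])).

Section Cells.
Variables (K : nat) (x : R).
Hypotheses (K0 : (0 < K)%N) (x0 : (0 <= x)%R).

Let a (j : nat) : R := (j%:R / K%:R)%R.

Let cell (j : nat) : set R := `]a j, a j.+1].

(* The j-th cell contains a point, and its last point is followed by an empty
   interval reaching at least x beyond the cell. *)
Let hit (j : nat) : set T :=
  void_event `]a j.+1, (a j.+1 + x)%R] `\` void_event `]a j, (a j.+1 + x)%R].

Let aS j : a j.+1 = (a j + K%:R^-1)%R.
Proof. by rewrite /a -natr1 mulrDl mul1r. Qed.

Let Kp : (0 < K%:R^-1 :> R)%R.
Proof. by rewrite invr_gt0 ltr0n. Qed.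

Let mhit j : measurable (hit j).
Proof. by apply: measurableD; exact: measurable_void. Qed.

(** A void longer interval makes the shorter one void, so the probability of the difference is a
    difference of probabilities; by stationarity only the lengths [x] and [x + 1/K] matter. *)
Let P_hit j : P (hit j) = P (void_event `]0%R, x]) - P (void_event `]0%R, (x + K%:R^-1)%R]).
Proof.
rewrite /hit measureD; [|exact: measurable_void..|]; last first.
  by rewrite (le_lt_trans (probability_le1 _ _)) ?ltry//; exact: measurable_void.
rewrite setIidr.
  congr (_ - _); first exact: void_event_itv.
  by rewrite aS -addrA [(_ + x)%R]addrC; exact: void_event_itv.
move=> w v n /=; rewrite in_itv/= => /andP[an nx]; apply: (v n).
by rewrite /= in_itv/= nx andbT (lt_trans _ an)// aS ltrDl.
Qed.

Let sum_points (t : int -> R) :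
  \sum_(j < K) points_in t (cell j) = points_in t `]0%R, 1%R].
Proof.
rewrite -esum_sum//; apply: eq_esum => n _.
by rewrite sumEFin indic_cells.
Qed.

Let sum_gaps (t : int -> R) y :
  \sum_(j < K) gaps_in t (cell j) y = gaps_in t `]0%R, 1%R] y.
Proof.
rewrite /gaps_in -esum_sum//.
apply: eq_esum => n _.
by rewrite sumEFin -mulr_suml indic_cells.
Qed.

Let gaps_points : {ae P, forall w,
  \sum_(j < K) (\1_(hit j) w)%:E + gaps_in (tau ^~ w) `]0%R, 1%R] x <=
    points_in (tau ^~ w) `]0%R, 1%R] /\
  points_in (tau ^~ w) `]0%R, 1%R] <=
  \sum_(j < K) (\1_(hit j) w)%:E + gaps_in (tau ^~ w) `]0%R, 1%R] (x + K%:R^-1)}.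
Proof.
move: ae_points; apply: filterS => w [t_lt t_ub t_lb].
have hitE j : \1_(hit j) w =
  (`[< void (tau^~ w) `]a j.+1, (a j.+1 + x)%R] /\
       ~ void (tau^~ w) `]a j, (a j.+1 + x)%R] >]%:R : R)%R.
  by rewrite indicE; congr (nat_of_bool _)%:R; apply/idP/asboolP; rewrite inE.
have a_le j : (a j <= a j.+1)%R by rewrite aS lerDl ltW.
have cells j := gaps_cell t_lt t_ub t_lb (a_le j) x0.
rewrite -(sum_points (tau ^~ w)) -!sum_gaps -!big_split/=.
split; apply: lee_sum => j _; rewrite hitE.
  by have [] := cells j.
have [_] := cells j.
by rewrite (_ : (a j.+1 - a j)%R = K%:R^-1%R)// aS addrAC subrr add0r.
Qed.

Lemma void_prob_step :
  (fine (intensity P tau) * (1 - H (x + K%:R^-1))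
     <= K%:R * (void_prob x - void_prob (x + K%:R^-1))
     <= fine (intensity P tau) * (1 - H x))%R.
Proof.
set m := fine (intensity P tau); pose v := void_prob.
rewrite -!/(v _).
have Iint : \int[P]_w points_in (tau ^~ w) `]0%R, 1%R] = m%:E.
  rewrite /m; case: renewal => _ _ /andP[I0 Ioo] _ _.
  by rewrite fineK// ge0_fin_numE// ltW.
have mhits : measurable_fun setT (fun w => \sum_(j < K) ((\1_(hit j) w : R)%:E)).
  apply: emeasurable_sum => j; apply/measurable_EFinP; exact: measurable_indic.
have hits0 w : 0 <= \sum_(j < K) ((\1_(hit j) w : R)%:E).
  by apply: sume_ge0 => j _; rewrite lee_fin.
have gaps0 y w : 0 <= gaps_in (tau ^~ w) `]0%R, 1%R] y.
  by apply: esum_ge0 => n _; rewrite lee_fin mulr_ge0.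
(* All [K] cells have the same hit probability, whence the factor [K]. Integrating the pathwise
   bounds with [y = x + 1/K] and [y = x] then gives the two inequalities. *)
have intD y : \int[P]_w (\sum_(j < K) (\1_(hit j) w)%:E +
      gaps_in (tau ^~ w) `]0%R, 1%R] y) =
    (K%:R * (v x - v (x + K%:R^-1)) + m * H y)%:E.
  rewrite ge0_integralD//; last exact: measurable_gaps_in.
  rewrite integral_gaps ge0_integral_sum//; last first.
    by move=> j; apply/measurable_EFinP; exact: measurable_indic.
  rewrite (eq_bigr (fun=> (v x - v (x + K%:R^-1))%:E)) => [|j _].
    by rewrite sumEFin sumr_const card_ord EFinD -[X in X%:E + _]mulr_natl.
  transitivity (P (hit j)); first by rewrite integral_indic// setIT.
  rewrite P_hit EFinB /v /void_prob !fineK//;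
  exact/fin_num_measure/measurable_void.
have points0 w : 0 <= points_in (tau ^~ w) `]0%R, 1%R].
  by apply: esum_ge0 => n _; rewrite lee_fin.
have mpts : measurable_fun setT (fun w => points_in (tau ^~ w) `]0%R, 1%R]).
  exact: measurable_points_in.
have msum y : measurable_fun setT (fun w => \sum_(j < K) (\1_(hit j) w : R)%:E +
      gaps_in (tau ^~ w) `]0%R, 1%R] y).
  by apply: emeasurable_funD => //; exact: measurable_gaps_in.
apply/andP; split.
  have : (m%:E <= (K%:R * (v x - v (x + K%:R^-1)) + m * H (x + K%:R^-1))%:E).
    rewrite -Iint -intD; apply: ae_ge0_le_integral => //.
      by move=> w _; rewrite adde_ge0.
    by move: gaps_points; apply: filterS => w [].
  by rewrite lee_fin; lra.
have : ((K%:R * (v x - v (x + K%:R^-1)) + m * H x)%:E <= m%:E).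
  rewrite -Iint -intD; apply: ae_ge0_le_integral => //.
    by move=> w _; rewrite adde_ge0.
  by move: gaps_points; apply: filterS => w [].
by rewrite lee_fin; lra.
Qed.

End Cells.

End PalmInversion.

(** * Law of the age at time 0 *)

(* Both sides have increments between those of a lower and an upper Riemann sum
   of the same monotone function, hence agree up to the mesh. *)
Lemma eq_integral_of_increments {R : realType} (V B h : R -> R) (m : R) :
  0 <= m -> {homo h : x y / x <= y} -> (forall x, 0 <= h x <= 1) ->
  V 0 = 1 -> {homo V : x y / x <= y >-> y <= x} -> B 0 = 0 ->
  (forall x y, 0 <= x -> x <= y ->
     (y - x) * (1 - h y) <= B y - B x <= (y - x) * (1 - h x)) ->
  (forall K x, (0 < K)%N -> 0 <= x ->
     m * (1 - h (x + K%:R^-1)) <= K%:R * (V x - V (x + K%:R^-1))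
       <= m * (1 - h x)) ->
  forall s, 0 <= s -> V s = 1 - m * B s.
Proof.
move=> m0 h_nd h01 V0 V_ni B0 dB dV s s0.
(* The claim is that [W] is constantly 1. Over one step, the decrease of [V] and the increase of
   [m * B] lie between the same two bounds, so [W] moves at most by their difference. *)
pose W x := V x + m * B x.
have step K x : (0 < K)%N -> 0 <= x ->
    `|W x - W (x + K%:R^-1)| <= m * K%:R^-1 * (h (x + K%:R^-1) - h x).
  move=> K0 x0.
  have Kp : 0 < K%:R :> R by rewrite ltr0n.
  have := dV K x K0 x0.
  have /(dB x _ x0) : x <= x + K%:R^-1 by rewrite lerDl invr_ge0 ltW.
  rewrite addrAC subrr add0r /W.
  have Ki : 0 < K%:R^-1 :> R by rewrite invr_gt0.
  move: (h x) (h (x + _)) (B x) (B (x + _)) (V x) (V (x + _)) => h1 h2 B1 B2 V1 V2.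
  have -> : K%:R * (V1 - V2) = (V1 - V2) / K%:R^-1 by rewrite invrK mulrC.
  move: (K%:R^-1) Ki => k k0; rewrite ler_pdivlMr// ler_pdivrMr//.
  move=> /andP[b1 b2] /andP[v1 v2].
  have := ler_wpM2l m0 b1; have := ler_wpM2l m0 b2.
  by rewrite ler_norml => ? ?; apply/andP; split; lra.
(* The increments of [h] telescope while the factor [m / K] stays outside, so the error does not
   grow with the number of steps. *)
have steps K x j : (0 < K)%N -> 0 <= x ->
    `|W x - W (x + j%:R * K%:R^-1)| <= m * K%:R^-1 * (h (x + j%:R * K%:R^-1) - h x).
  move=> K0 x0; elim: j => [|j IH]; first by rewrite mul0r addr0 !subrr normr0 mulr0.
  have xj0 : 0 <= x + j%:R * K%:R^-1 by rewrite addr_ge0// mulr_ge0// invr_ge0.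
  rewrite -natr1 mulrDl mul1r addrA.
  apply: le_trans (ler_distD (W (x + j%:R * K%:R^-1)) _ _) _.
  apply: le_trans (lerD IH (step K _ K0 xj0)) _.
  by rewrite le_eqVlt; apply/orP; left; apply/eqP; ring.
(* The constant 3 allows one [m / K] for the grid steps, one for [1 - V r] and one for [m * B r]. *)
have close K : (0 < K)%N -> `|W s - 1| <= 3 * m * K%:R^-1.
  move=> K0; have Kp : 0 < K%:R :> R by rewrite ltr0n.
  have Ki : 0 < K%:R^-1 :> R by rewrite invr_gt0.
  (* The grid of mesh [1/K] ends at [s]; it starts at a remainder [r] between 0 and [1/K]. *)
  pose j := Num.truncn (s * K%:R).
  have sK0 : 0 <= s * K%:R by rewrite mulr_ge0// ltW.
  have /andP[j1 j2] := truncn_itv sK0.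
  pose r := s - j%:R * K%:R^-1.
  have r0 : 0 <= r by rewrite subr_ge0 ler_pdivrMr.
  have rK : r <= K%:R^-1.
    by rewrite lerBlDr -[X in X + _]mul1r -mulrDl nat1r ler_pdivlMr// ltW.
  have sE : s = r + j%:R * K%:R^-1 by rewrite subrK.
  have := steps K r j K0 r0; rewrite -sE.
  have mK0 : 0 <= m * K%:R^-1 by rewrite mulr_ge0// ltW.
  have hs : h s - h r <= 1 by have := h01 s; have := h01 r; lra.
  have := ler_wpM2l mK0 hs; rewrite mulr1 => /[swap] /le_trans /[apply].
  have := dV K 0 K0 (lexx 0); rewrite add0r V0 => /andP[_ v2].
  have v3 : 1 - V K%:R^-1 <= m * K%:R^-1.
    rewrite -(ler_pM2l Kp) mulrCA divff ?gt_eqF// mulr1.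
    by apply: le_trans v2 _; rewrite ler_piMr//; have := h01 0; lra.
  have v4 := V_ni _ _ rK; have v5 := V_ni _ _ r0.
  have := dB 0 r (lexx 0) r0; rewrite B0 !subr0 => /andP[b1 b2].
  have b3 : 0 <= B r by apply: le_trans b1; rewrite mulr_ge0//; have := h01 r; lra.
  have b4 : B r <= K%:R^-1.
    apply: le_trans b2 _; apply: le_trans rK; rewrite ler_piMr//.
    by have := h01 0; lra.
  have := ler_wpM2l m0 b4; have := mulr_ge0 m0 b3.
  rewrite V0 in v5.
  rewrite /W !ler_norml => ? ? /andP[? ?]; apply/andP; split; lra.
suff : W s = 1 by rewrite /W; lra.
apply/eqP; rewrite -subr_eq0; apply/negPn/negP => Ws.
have Wp : 0 < `|W s - 1| by rewrite normr_gt0.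
have [K K0] : exists2 K, (0 < K)%N & 3 * m / `|W s - 1| < K%:R.
  by exists (Num.truncn (3 * m / `|W s - 1|)).+1 => //; exact: truncnS_gt.
rewrite ltr_pdivrMr// => lt; have := close K K0.
rewrite leNgt => /negP; apply.
by rewrite ltr_pdivrMr ?ltr0n// [ltRHS]mulrC.
Qed.

(** * Distribution functions, atoms and half-lines *)

Section DistributionFunctionTheory.
Context {R : realType}.
Implicit Type mu : probability (measurableTypeR R) R.

Let idR : measurableTypeR R -> R := idfun.

#[local] HB.instance Definition _ :=
  @isMeasurableFun.Build _ _ _ _ idR (@measurable_id _ _ setT).

Lemma df_EFin mu x : (df mu x)%:E = mu `]-oo, x]%classic.
Proof. by rewrite fineK// fin_num_measure. Qed.

Lemma df_ge0 mu x : 0 <= df mu x.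
Proof. by rewrite fine_ge0. Qed.

Lemma df_le1 mu x : df mu x <= 1.
Proof. by rewrite -lee_fin df_EFin probability_le1. Qed.

Lemma df_is_df mu : is_df (df mu).
Proof.
split.
- move=> x y xy; rewrite -lee_fin !df_EFin le_measure ?inE//.
  exact: subset_itvl.
- move=> a; apply: fine_cvg; rewrite -/(df mu a) df_EFin.
  exact: (@cdf_right_continuous _ _ _ mu idR).
- by apply: fine_cvg; exact: (@cvg_cdfNy0 _ _ _ mu idR).
- by apply: fine_cvg; exact: (@cvg_cdfy1 _ _ _ mu idR).
Qed.

Lemma df_nd mu : {homo df mu : x y / x <= y}.
Proof. by case: (df_is_df mu). Qed.

Lemma df_split mu x : (df mu x)%:E = (mu `]-oo, x[%classic + mu [set x])%E.
Proof.
rewrite df_EFin -measureU//; last first.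
  by apply/seteqP; split=> y//= -[]; rewrite in_itv/= => /[swap] ->; rewrite ltxx.
congr (mu _); apply/seteqP; split=> y/=; rewrite !in_itv/= le_eqVlt.
  by move=> /predU1P[->|]; [right|left].
by case=> [->|->]; rewrite ?eqxx ?orbT.
Qed.

Lemma measure_ray mu x : (mu `[x, +oo[%classic = 1 - mu `]-oo, x[%classic)%E.
Proof. by rewrite -setCitvl probability_setC. Qed.

(** The atom is bounded by every left increment [df mu x - df mu (x - r / 2)]. Conversely, right
    continuity always holds, and without an atom the half-lines ending at [x - 1/(n + 1)] exhaust
    the mass of the one ending at [x]. *)
Lemma df_continuousP mu x : {for x, continuous (df mu)} <-> mu [set x] = 0%E.
Proof.
split=> [c|a0].
  apply/eqP; rewrite eq_le measure_ge0 andbT; apply/lee_addgt0Pr => e e0.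
  rewrite add0e.
  have /cvgrPdist_lt/(_ e e0)[r /= r0 /(_ (x - r / 2))] := c.
  rewrite /ball/= opprB addrC subrK gtr0_norm ?divr_gt0//.
  rewrite ltr_pdivrMr// ltr_pMr// ltr1n => /(_ isT) dxy.
  have : ((df mu (x - r / 2))%:E + mu [set x] <= (df mu x)%:E)%E.
    rewrite [leRHS]df_split df_EFin leeD2r// le_measure ?inE//.
    by apply: subset_itvl; rewrite bnd_simp ltrBlDr ltrDl divr_gt0.
  rewrite -leeBrDl// -EFinB => /le_trans; apply.
  by rewrite lee_fin (le_trans (ler_norm _))// ltW.
apply/cvgrPdist_lt => e e0.
have [_ rc _ _] := df_is_df mu.
have [r r0 rP] : exists2 r, 0 < r & df mu x - df mu (x - r) < e.
  have : mu (`]-oo, x - n.+1%:R^-1])%classic @[n --> \oo] --> mu `]-oo, x[%classic.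
    have -> : `]-oo, x[%classic = \bigcup_n `]-oo, x - n.+1%:R^-1]%classic.
      apply/seteqP; split=> y/= => [|[n _]/=]; rewrite !in_itv/=.
        by move=> /ltr_add_invr[n nx]; exists n => //=; rewrite in_itv/= lerBrDr ltW.
      by move=> /le_lt_trans; apply; rewrite ltrBlDr ltrDl invr_gt0.
    apply: nondecreasing_cvg_mu => //.
      exact: bigcup_measurable.
    move=> m n mn; apply/subsetPset; apply: subset_itvl.
    by rewrite bnd_simp lerD2l lerN2 lef_pV2 ?posrE// ler_nat.
  have -> : mu `]-oo, x[%classic = (df mu x)%:E by rewrite df_split a0 adde0.
  move/fine_cvg => /cvgrPdist_lt/(_ e e0)[n _ /(_ n (leqnn n))]/= h.
  by exists n.+1%:R^-1 => //; exact: le_lt_trans (ler_norm _) h.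
have /cvgrPdist_lt/(_ e e0) := rc x.
rewrite near_withinE => -[/= s s0 sP].
exists (Num.min r s) => [|y]; first by rewrite /= lt_min r0.
rewrite /ball/= lt_min => /andP[yr ys].
have [xy|yx] := ltP x y; first exact: sP.
rewrite ger0_norm ?subr_ge0 ?df_nd//; apply: le_lt_trans rP.
rewrite lerD2l lerN2 df_nd// lerBlDr -lerBlDl.
by rewrite (le_trans (ler_norm _))// ltW.
Qed.

(** Closed right half-lines form a generating class stable under intersection. They are chosen
    because an age being at least [c] is a void event up to a null set. *)
Lemma eq_measure_rays (m1 m2 : {measure set (measurableTypeR R) -> \bar R}) :
  (forall c, m1 `[c, +oo[%classic = m2 `[c, +oo[%classic) ->
  (forall c, m1 `[c, +oo[%classic < +oo)%E ->
  forall A, measurable A -> m1 A = m2 A.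
Proof.
move=> m12 m1oo A mA.
apply: (@measure_unique _ R (measurableTypeR R) (@RGenCInfty.G R)
  (fun n => `[- n%:R, +oo[%classic) _ _ _ _ m1 m2) => //.
- exact: RGenCInfty.measurableE.
- move=> _ _ [x ->] [y ->]; exists (Num.max x y).
  apply/seteqP; split=> z/=; rewrite !in_itv/= !andbT ge_max.
    by move=> [-> ->].
  by move=> /andP[].
- by move=> n; exists (- n%:R).
- rewrite -subTset => x _; exists (Num.truncn `|x|).+1 => //=.
  rewrite in_itv/= andbT lerNl (le_trans (ler_norm _))// normrN.
  exact/ltW/truncnS_gt.
- by move=> _ [x ->].
Qed.

End DistributionFunctionTheory.

(** * Regularity of the age distribution function *)

Section AgeDistribution.
Context {R : realType} (F0 : probability (measurableTypeR R) R).

Lemma age_df_le0 x : x <= 0 -> age_df F0 x = 0.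
Proof.
move=> x0; rewrite /age_df; have [->|xn0] := eqVneq x 0.
  by rewrite set_itv1 Rintegral_set1.
by rewrite set_itv_ge ?Rintegral_set0// bnd_simp -ltNge lt_neqAle xn0.
Qed.

(** The integrand is nonincreasing, so its extreme values on the interval are at the endpoints.
    After rescaling, these are the bounds required of [B] in [eq_integral_of_increments]. *)
Lemma age_df_increment x y : 0 <= x -> x <= y ->
  (y - x) * (1 - df F0 y) <= age_df F0 y - age_df F0 x <= (y - x) * (1 - df F0 x).
Proof.
move=> x0 xy.
have itg : lebesgue_measure.-integrable `[0, y]%classic
    (EFin \o (fun s => 1 - df F0 s)).
  apply: measurable_bounded_integrable => //.
  - by apply: compact_finite_measure; exact: segment_compact.
  - apply: measurable_funB => //; apply: nondecreasing_measurable => //.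
    exact: df_nd.
  - exists 1; split => // M M1 s _ /=; rewrite (le_trans _ (ltW M1))//.
    by have := df_ge0 F0 s; have := df_le1 F0 s; rewrite ler_norml => ? ?; lra.
have sub : `]x, y]%classic `<=` `[0, y]%classic by apply: subset_itvr.
have itgc c : lebesgue_measure.-integrable `]x, y]%classic (EFin \o cst (c : R)).
  apply: measurable_bounded_integrable => //; last exact: bounded_cst.
  apply: (@le_lt_trans _ _ (lebesgue_measure `[0, y]%classic)).
    by rewrite le_measure ?inE.
  by apply: compact_finite_measure; exact: segment_compact.
have lxy : fine (lebesgue_measure `]x, y]%classic) = y - x.
  rewrite lebesgue_measure_itv/= lte_fin; case: ltP => //= yx.
  by apply/esym/eqP; rewrite subr_eq0 eq_le yx xy.
rewrite /age_df Rintegral_itvB ?bnd_simp//.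
have itgxy : lebesgue_measure.-integrable `]x, y]%classic
    (EFin \o (fun s => 1 - df F0 s)) by exact: integrableS itg.
apply/andP; split; rewrite mulrC -lxy -Rintegral_cst//;
  apply: le_Rintegral => //; try exact: itgxy; try exact: itgc;
  move=> s /=; rewrite in_itv/= => /andP[/ltW xs sy];
  by rewrite lerD2l lerN2 df_nd.
Qed.

Lemma age_df_lipschitz x y : x <= y -> 0 <= age_df F0 y - age_df F0 x <= y - x.
Proof.
have pos u v : 0 <= u -> u <= v -> 0 <= age_df F0 v - age_df F0 u <= v - u.
  move=> u0 uv; have /andP[h1 h2] := age_df_increment u0 uv.
  have := df_le1 F0 v; have := df_ge0 F0 u => d1 d2.
  have vu : 0 <= v - u by rewrite subr_ge0.
  rewrite (le_trans _ h1) ?mulr_ge0 ?subr_ge0//=.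
  by apply: le_trans h2 _; rewrite ler_piMr//; lra.
have [x0 xy|/ltW x0 xy] := leP 0 x; first exact: pos.
have [y0|/ltW y0] := leP 0 y; last first.
  by rewrite (age_df_le0 x0) (age_df_le0 y0) subrr lexx subr_ge0.
have := pos 0 y (lexx 0) y0; rewrite !(age_df_le0 x0) (age_df_le0 (lexx 0)) !subr0.
by move=> /andP[-> /= h]; lra.
Qed.

Lemma age_df_continuous : continuous (age_df F0).
Proof.
move=> x; apply/cvgrPdist_lt => e e0; exists e => // y /=; apply: le_lt_trans.
have [xy|/ltW yx] := leP x y.
  have /andP[h1 h2] := age_df_lipschitz xy.
  by rewrite [leLHS]distrC [leRHS]distrC !ger0_norm// subr_ge0.
have /andP[h1 h2] := age_df_lipschitz yx.
by rewrite !ger0_norm// subr_ge0.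
Qed.

End AgeDistribution.

Section MeasureAe.
Context {R : realType} {d : measure_display} {T : measurableType d}.
Variable mu : {measure set T -> \bar R}.

Lemma le_measure_ae (A B : set T) : measurable A -> measurable B ->
  {ae mu, forall w, A w -> B w} -> (mu A <= mu B)%E.
Proof.
move=> mA mB AB.
rewrite -[A]setIT -[B]setIT -!integral_indic//.
apply: ae_ge0_le_integral => //; try exact/measurable_EFinP/measurable_indic.
move: AB; apply: filterS => w AB _; rewrite lee_fin !indicE.
have [|] := boolP (w \in A); last by [].
by rewrite inE => /AB Bw; rewrite mem_set.
Qed.

Lemma eq_measure_ae (A B : set T) : measurable A -> measurable B ->
  {ae mu, forall w, A w <-> B w} -> mu A = mu B.
Proof.
move=> mA mB AB; apply/eqP; rewrite eq_le !le_measure_ae//;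
by move: AB; apply: filterS => w [].
Qed.

End MeasureAe.

(** * The scaled age at time 0 has the age distribution *)

Section AgeLaw.
Context {R : realType} {d : measure_display} {T : measurableType d}.
Variables (P : probability T R) (F0 F : probability (measurableTypeR R) R).
Hypothesis F_age : forall t, df F t = age_df F0 t.
Variables (tau : int -> T -> R) (l : R).
Hypothesis l0 : 0 < l.
Hypothesis renewal : stationary_renewal P tau (fun t => df F0 (l * t)).

Let mtau : measurable_fun setT (tau 0).
Proof. by case: renewal => -[]. Qed.

(** Almost surely [tau 0] is the last point at or before 0 and [tau 1] is positive. For [t <= 0] the
    interval is empty and both sides hold. *)
Lemma last_point_void (t : R) :
  {ae P, forall w, void_event tau `]- t, 0]%classic w <-> tau 0 w <= - t}.
Proof.
case: renewal => -[_ + _ _ _ _]; apply: filterS => w [/andP[t0 t1] t_lt _ _].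
split=> [v|tt n /=]; last first.
  rewrite in_itv/= => /andP[tn n0].
  have : ~~ (n <= 0)%R.
    rewrite le_eqVlt negb_or; apply/andP; split.
      by apply: contraTneq tn => ->; rewrite -leNgt.
    apply/negP => /(int_seq_lt t_lt) h.
    by move: (lt_trans tn (lt_le_trans h tt)); rewrite ltxx.
  rewrite -ltNge => n1; have [n1E|n1E] := eqVneq n 1.
    by move: n0; rewrite n1E leNgt t1.
  have /(int_seq_lt t_lt) : (1 < n)%R by lia.
  by move=> /(lt_trans t1); rewrite ltNge n0.
by rewrite leNgt; apply/negP => h; apply: (v 0); rewrite /= in_itv/= h.
Qed.

Let mage : measurable_fun setT (fun w => l * - tau 0 w).
Proof. by apply: measurable_funM => //; exact: measurableT_comp. Qed.

Let age_fun (w : T) : measurableTypeR R := l * - tau 0 w.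

#[local] HB.instance Definition _ :=
  @isMeasurableFun.Build _ _ T (measurableTypeR R) age_fun mage.

Let age : {mfun T >-> measurableTypeR R} := age_fun.

Let age_ray c : P ((fun w => l * - tau 0 w) @^-1` `[c, +oo[%classic) =
  (void_prob P tau (c / l))%:E.
Proof.
have mv : measurable (void_event tau `]- (c / l), 0]%classic).
  exact: (measurable_void renewal).
rewrite /void_prob -(void_event_itv renewal (- (c / l))) addNr fineK; last first.
  exact: fin_num_measure.
apply: eq_measure_ae => //.
  by rewrite -[X in measurable X]setTI; exact: mage.
move: (last_point_void (c / l)); apply: filterS => w /= ->.
by rewrite in_itv/= andbT mulrC -ler_pdivrMr// lerNr.
Qed.

Let void_prob_le0 x : x <= 0 -> void_prob P tau x = 1.
Proof.
move=> x0; rewrite /void_prob (_ : void_event _ _ = setT) ?probability_setT//.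
apply/seteqP; split=> // w _ n /=; rewrite in_itv/= => /andP[h1 h2].
by move: (lt_le_trans h1 (le_trans h2 x0)); rewrite ltxx.
Qed.

Let void_prob_ni : {homo void_prob P tau : x y / x <= y >-> y <= x}.
Proof.
move=> x y xy.
have mv z : measurable (void_event tau `]0, z]%classic).
  exact: (measurable_void renewal).
rewrite fine_le ?fin_num_measure// le_measure ?inE// => w v n wn.
by apply: (v n); move: wn; rewrite /= !in_itv/= => /andP[-> /le_trans ->].
Qed.

Lemma age_law (A : set (measurableTypeR R)) : measurable A ->
  P ((fun w => l * - tau 0 w) @^-1` A) = F A.
Proof.
move=> mA.
have F_cont c : F [set c] = 0%E.
  by apply/df_continuousP; rewrite (funext F_age); exact: age_df_continuous.
have F_ray c : F `[c, +oo[%classic = (1 - df F c)%:E.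
  by rewrite measure_ray EFinB df_split F_cont adde0.
pose m := fine (intensity P tau).
have m0 : 0 <= m by rewrite fine_ge0//; case: renewal => _ _ /andP[/ltW].
(* The increment comparison is applied with [B x = age_df F0 (l * x) / l], an antiderivative of
   [1 - df F0 (l * x)]. *)
have nuE c : distribution P age `[c, +oo[%classic = (1 - m / l * df F c)%:E.
  rewrite /distribution /pushforward/= age_ray F_age; congr _%:E.
  have [c0|/ltW c0] := leP 0 c; last first.
    rewrite void_prob_le0 ?age_df_le0 ?mulr0 ?subr0//.
    by rewrite mulr_le0_ge0// invr_ge0 ltW.
  rewrite (@eq_integral_of_increments _ (void_prob P tau)
    (fun x => age_df F0 (l * x) / l) (fun x => df F0 (l * x)) m) //.
  - by rewrite [l * _]mulrC divfK ?gt_eqF// mulrCA mulrC [_ / l * _]mulrC.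
  - by move=> x y xy; rewrite df_nd// ler_pM2l.
  - by move=> x; rewrite df_ge0 df_le1.
  - exact: void_prob_le0.
  - by rewrite mulr0 age_df_le0// mul0r.
  - move=> x y x0 xy; rewrite -mulrBl ler_pdivrMr// ler_pdivlMr//.
    have lx0 : 0 <= l * x by rewrite mulr_ge0// ltW.
    have lxy : l * x <= l * y by rewrite ler_pM2l.
    by have := age_df_increment F0 lx0 lxy; rewrite -mulrBr; lra.
  - by move=> K x K0 x0; exact: (void_prob_step renewal).
  - by rewrite divr_ge0// ltW.
pose nu : probability (measurableTypeR R) R := distribution P age.
have nu_itv c : nu `]-oo, c[%classic = (m / l * df F c)%:E.
  rewrite -setCitvr probability_setC//.
  have -> : nu `[c, +oo[%classic = (1 - m / l * df F c)%:E := nuE c.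
  by rewrite -EFinB opprB addrC subrK.
have [_ _ _ F1] := df_is_df F; have [_ _ _ nu1] := df_is_df nu.
(* Both laws have total mass 1, so letting [c] tend to infinity identifies the factor. The shift to
   [c + 1] passes from a closed half-line to an open one. *)
have ml1 : m / l = 1.
  apply/eqP; rewrite eq_le; apply/andP; split.
    rewrite -[leLHS]mulr1; apply: (cvgr_to_le (cvgM (cvg_cst _) F1)).
    near=> c; rewrite -lee_fin -nu_itv; exact: probability_le1.
  apply: (cvgr_to_le nu1); near=> c.
  have ml0 : 0 <= m / l by rewrite divr_ge0// ltW.
  apply: (@le_trans _ _ (m / l * df F (c + 1))).
    rewrite -lee_fin -nu_itv df_EFin le_measure ?inE//.
    by apply: subset_itvl; rewrite bnd_simp ltrDl.
  by rewrite ler_piMr// df_le1.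
apply: (@eq_measure_rays _ nu F) => // c.
  by have := nuE c; rewrite ml1 mul1r => /eqP; rewrite -F_ray => /eqP.
by rewrite -ge0_fin_numE// fin_num_measure.
Unshelve. all: by end_near. Qed.

End AgeLaw.

(** * Strong law for independent events in a triangular array *)

(** This is uniqueness on half-lines for the image measures under [X]; the measures on [T] need not
    be probabilities, so that a restriction can be compared with a multiple. *)
Lemma eq_preimage_rays {R : realType} {d : measure_display} {T : measurableType d}
    (m1 m2 : {measure set T -> \bar R}) (X : {mfun T >-> measurableTypeR R}) :
  (forall c, m1 (X @^-1` `[c, +oo[%classic) = m2 (X @^-1` `[c, +oo[%classic)) ->
  (forall c, m1 (X @^-1` `[c, +oo[%classic) < +oo)%E ->
  forall A, measurable A -> m1 (X @^-1` A) = m2 (X @^-1` A).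
Proof.
move=> m12 m1oo A mA; have mX := measurable_funPT X.
pose push (m : {measure set T -> \bar R}) : {measure set (measurableTypeR R) -> \bar R} :=
  measure_function_pushforward__canonical__measure_function_Measure m mX.
exact: (@eq_measure_rays _ (push m1) (push m2)).
Qed.

Lemma measurable_forall_fin {d : measure_display} {T : measurableType d}
    (I : finType) (Q : pred I) (E : I -> set T) : (forall i, Q i -> measurable (E i)) ->
  measurable [set w | forall i, Q i -> E i w].
Proof.
move=> mE; rewrite (_ : [set w | _] = \bigcap_(i in [set` Q]) E i).
  by apply: fin_bigcap_measurable => // i; exact: mE.
by apply/seteqP; split=> w h i; exact: h.
Qed.

(** * Independence extended from half-lines to Borel sets *)

Section IndependentRays.
Context {R : realType} {d : measure_display} {T : measurableType d}.
Variables (P : probability T R) (n : nat).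
Variable X : 'I_n -> {mfun T >-> measurableTypeR R}.
Hypothesis X_ray : forall c : 'I_n -> R,
  P [set w | forall i, `[c i, +oo[%classic (X i w)] =
  (\prod_(i < n) P (X i @^-1` `[c i, +oo[%classic))%E.

Let mX i (B : set (measurableTypeR R)) : measurable B -> measurable (X i @^-1` B).
Proof. exact: measurable_funPTI. Qed.

Lemma independent_of_rays (B : 'I_n -> set (measurableTypeR R)) :
  (forall i, measurable (B i)) ->
  P [set w | forall i, B i (X i w)] = (\prod_(i < n) P (X i @^-1` B i))%E.
Proof.
move=> mB.
(* Coordinates are freed one at a time: those below [k] carry arbitrary Borel sets, the others still
   carry half-lines. *)
suff H k : (k <= n)%N -> forall B : 'I_n -> set (measurableTypeR R),
    (forall i, measurable (B i)) ->
    (forall i : 'I_n, (k <= i)%N -> exists c, B i = `[c, +oo[%classic) ->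
    P [set w | forall i, B i (X i w)] = (\prod_(i < n) P (X i @^-1` B i))%E.
  by apply: (H n (leqnn n)) => // i; rewrite leqNgt ltn_ord.
elim: k => [_|k IH kn] {mB} {}B mB Bray.
  have [c Bc] := choice (fun i => Bray i isT).
  by rewrite (_ : B = fun i => `[c i, +oo[%classic) ?X_ray//; exact/funext.
pose i0 := Ordinal kn.
pose E := [set w | forall i, i != i0 -> B i (X i w)].
have mE : measurable E by apply: measurable_forall_fin => i _; exact: mX.
pose c : \bar R := (\prod_(i < n | i != i0) P (X i @^-1` B i))%E.
have c0 : (0 <= c)%E by apply: prode_ge0.
have cfin : c \is a fin_num.
  by apply: prode_fin_num => i _; rewrite fin_num_measure//; exact: mX.
(* As functions of the set at [i0], the two sides are [P] restricted to the event on the other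
   coordinates and [P] multiplied by the product of the other factors. The induction hypothesis
   makes them agree on half-lines. *)
pose m1 : {measure set T -> \bar R} := mrestr P mE.
pose m2 : {measure set T -> \bar R} := mscale (NngNum (fine_ge0 c0)) P.
have m12 : m1 (X i0 @^-1` B i0) = m2 (X i0 @^-1` B i0).
  apply: eq_preimage_rays => // a; last first.
    rewrite -ge0_fin_numE ?measure_ge0//; apply: fin_num_measure.
    exact: mX.
  pose B' i := if i == i0 then `[a, +oo[%classic else B i.
  have B'N i : i != i0 -> B' i = B i by rewrite /B' => /negPf ->.
  have B'0 : B' i0 = `[a, +oo[%classic by rewrite /B' eqxx.
  transitivity (P [set w | forall i, B' i (X i w)]).
    rewrite /m1 /= /mrestr; congr (P _).
    apply/seteqP; split=> w /= => [[h1 h2] i|h].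
      by have [->|ni] := eqVneq i i0; [rewrite B'0|rewrite B'N//; exact: h2].
    by split=> [|i ni]; [have := h i0; rewrite B'0|have := h i; rewrite B'N].
  rewrite IH ?(ltnW kn)//; last 2 first.
  - by move=> i; rewrite /B'; case: ifP.
  - move=> i ki; have [->|ni] := eqVneq i i0; first by exists a.
    rewrite B'N//; apply: Bray; rewrite ltn_neqAle ki andbT.
    by apply: contra ni => /eqP ki'; apply/eqP/val_inj; rewrite /= ki'.
  rewrite (bigD1 i0)//= B'0 /m2 /mscale/= fineK// muleC; congr (_ * _)%E.
  by apply: eq_bigr => i ni; rewrite B'N.
transitivity (m1 (X i0 @^-1` B i0)).
  rewrite /m1 /= /mrestr; congr (P _).
  apply/seteqP; split=> w /= => [h|[h1 h2] i]; first by split.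
  by have [->//|/h2] := eqVneq i i0.
by rewrite m12 [RHS](bigD1 i0)//= /m2/= /mscale/= fineK// muleC.
Qed.

End IndependentRays.

(** * Exponential deviation bound for independent events *)

Section Chernoff.
Context {R : realType}.

(** From [1 - s <= expR (- s)] one gets [(1 - s) * expR s <= 1], while
    [(1 - s) * (1 + s + 2 * s ^+ 2)] equals [1 + s ^+ 2 * (1 - 2 * s)], which is at least 1. *)
Lemma expR_le_quadratic (s : R) : 0 <= s -> s <= 2^-1 ->
  expR s <= 1 + s + 2 * s ^+ 2.
Proof.
move=> s0 s2.
have s1 : 0 < 1 - s by lra.
have /(ler_wpM2r (expR_ge0 s)) := expR_ge1Dx (- s).
rewrite -expRD addNr expR0 => h.
have : 1 <= (1 - s) * (1 + s + 2 * s ^+ 2).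
  have : 0 <= s ^+ 2 * (1 - 2 * s) by rewrite mulr_ge0 ?sqr_ge0//; lra.
  lra.
by move=> /(le_trans h); rewrite ler_pM2l.
Qed.

(* [exp (- s p) (1 + p (exp s - 1)) <= exp (p (exp s - 1 - s))] *)
Lemma bernoulli_mgf_le (s p : R) : 0 <= s -> s <= 2^-1 -> 0 <= p <= 1 ->
  p * expR (s * (1 - p)) + (1 - p) * expR (s * - p) <= expR (2 * s ^+ 2).
Proof.
move=> s0 s2 /andP[p0 p1].
have -> : p * expR (s * (1 - p)) + (1 - p) * expR (s * - p) =
    expR (- (s * p)) * (1 + p * (expR s - 1)).
  by rewrite mulrBr mulr1 expRD mulrN; ring.
apply: (@le_trans _ _ (expR (- (s * p)) * expR (p * (expR s - 1)))).
  by rewrite ler_wpM2l ?expR_ge0// expR_ge1Dx.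
rewrite -expRD ler_expR.
have := expR_le_quadratic s0 s2; have : 0 <= s ^+ 2 by rewrite sqr_ge0.
move: (expR s) (s ^+ 2) => e q q0 eq.
have : p * (e - 1 - s) <= p * (2 * q) by rewrite ler_wpM2l//; lra.
have : p * (2 * q) <= 1 * (2 * q) by rewrite ler_wpM2r//; lra.
lra.
Qed.

Context {d : measure_display} {T : measurableType d}.
Variable P : probability T R.

Section UpperTail.
Variables (n : nat) (A : 'I_n -> set T) (p : 'I_n -> R).
Hypothesis mA : forall i, measurable (A i).
Hypothesis p01 : forall i, 0 <= p i <= 1.

Definition bernoulli_weight (i : 'I_n) (b : bool) : R := if b then p i else 1 - p i.

(** These are the atoms of the algebra generated by the [A i]. Prescribing their probabilities as
    products expresses independence, and expectations become finite sums over [y]. *)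
Definition pattern (y : 'I_n -> bool) : set T :=
  [set w | forall i, (if y i then A i else ~` A i) w].

Hypothesis P_pattern : forall y, P (pattern y) =
  (\prod_(i < n) bernoulli_weight i (y i))%:E.

Lemma measurable_pattern y : measurable (pattern y).
Proof.
rewrite (_ : pattern y = [set w | forall i, xpredT i -> (if y i then A i else ~` A i) w]).
  by apply: measurable_forall_fin => i _; case: (y i) => //; exact: measurableC.
by apply/seteqP; split=> w h i; [move=> _|]; exact: h.
Qed.

Lemma measurable_deviation (q : 'I_n -> R) (a : R) :
  measurable [set w | a <= \sum_(i < n) (\1_(A i) w - q i)].
Proof.
have mS : measurable_fun setT (fun w => \sum_(i < n) (\1_(A i) w - q i)).
  by apply: measurable_sum => i; apply: measurable_funB.
rewrite -[X in measurable X]setTI.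
have := mS measurableT `[a, +oo[%classic (measurable_itv _).
by congr (measurable _); apply/seteqP; split=> w [_ /=]; rewrite in_itv/= andbT.
Qed.

Lemma chernoff_upper (e : R) : 0 <= e <= 2 ->
  (P [set w | n%:R * e <= \sum_(i < n) (\1_(A i) w - p i)]%R
     <= (expR (- (e ^+ 2 / 8)) ^+ n)%:E)%E.
Proof.
move=> /andP[e0 e2]; set D := [set w | _].
have mD : measurable D by exact: measurable_deviation.
(* This [s] minimizes [2 * s ^+ 2 - s * e], with value [- e ^+ 2 / 8]; [e <= 2] ensures
   [s <= 1/2]. *)
pose s := e / 4.
have s0 : 0 <= s by rewrite divr_ge0.
have s2 : s <= 2^-1 by rewrite /s; lra.
pose c (y : {ffun 'I_n -> bool}) : R :=
  expR (s * (\sum_(i < n) ((y i)%:R - p i) - n%:R * e)).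
have c0 y : 0 <= c y by exact: expR_ge0.
have mterm y : measurable_fun setT (fun w => ((c y * \1_(pattern y) w : R)%:E)).
  by apply/measurable_EFinP/measurable_funM => //; exact/measurable_indic/measurable_pattern.
(* Markov's inequality for the exponential: on [D] the pattern that occurs has weight at least 1. *)
apply: (@le_trans _ _ (\int[P]_w (\sum_y (c y * \1_(pattern y) w)%:E))%E).
  rewrite -[D]setIT -integral_indic//; apply: ge0_le_integral => //.
  - by apply/measurable_EFinP; exact: measurable_indic.
  - exact: emeasurable_sum.
  move=> w _; rewrite sumEFin lee_fin indicE.
  have [|_] := boolP (w \in D); last by rewrite sumr_ge0// => y _; rewrite mulr_ge0.
  rewrite inE => Dw.
  pose y0 := [ffun i => w \in A i].
  rewrite (bigD1 y0)//= (_ : \1_(pattern y0) w = 1); last first.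
    rewrite indicE mem_set// => i; rewrite ffunE.
    by case: (boolP (w \in A i)); [rewrite inE|rewrite notin_setE].
  rewrite mulr1 ler_wpDr ?sumr_ge0//; first by move=> y _; rewrite mulr_ge0.
  rewrite -[leLHS]expR0 ler_expR mulr_ge0// subr_ge0.
  by apply: le_trans Dw _; apply: ler_sum => i _; rewrite ffunE indicE.
rewrite ge0_integral_sum//; last by move=> y w _; rewrite lee_fin mulr_ge0.
have int_term y : (\int[P]_w (c y * \1_(pattern y) w)%:E =
    (c y * \prod_(i < n) bernoulli_weight i (y i))%:E)%E.
  under eq_integral do rewrite EFinM.
  rewrite ge0_integralZl_EFin//; last first.
    by apply/measurable_EFinP/measurable_indic/measurable_pattern.
  by rewrite integral_indic ?setIT//; [rewrite EFinM -P_pattern|exact: measurable_pattern].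
rewrite (eq_bigr _ (fun y _ => int_term y)) sumEFin lee_fin.
have cE y : c y * \prod_(i < n) bernoulli_weight i (y i) =
    \prod_(i < n) (expR (- (s * e)) *
      (bernoulli_weight i (y i) * expR (s * ((y i)%:R - p i)))).
  rewrite !big_split/= prodr_const card_ord -expRM_natl -expR_sum -mulr_sumr.
  rewrite [RHS]mulrCA [LHS]mulrC -expRD /c; congr (_ * expR _).
  by rewrite sumrB; ring.
(* Distributivity turns the sum over patterns of products into a product of two-term sums, each a
   centred Bernoulli generating function. *)
rewrite (eq_bigr _ (fun y _ => cE y)) -(bigA_distr_bigA (fun i b => expR (- (s * e)) *
      (bernoulli_weight i b * expR (s * (b%:R - p i)))))/=.
have -> : expR (- (e ^+ 2 / 8)) ^+ n = \prod_(i < n) expR (- (e ^+ 2 / 8)).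
  by rewrite prodr_const card_ord.
apply: ler_prod => i _; rewrite big_bool/= /bernoulli_weight -mulrDr.
have := bernoulli_mgf_le s0 s2 (p01 i) => h.
rewrite sub0r mulr_ge0 ?expR_ge0//=; last first.
  by have /andP[? ?] := p01 i; rewrite addr_ge0// mulr_ge0 ?expR_ge0// subr_ge0.
apply: le_trans (ler_wpM2l (expR_ge0 _) h) _.
by rewrite -expRD ler_expR /s; lra.
Qed.

End UpperTail.

End Chernoff.

Section StrongLaw.
Context {R : realType} {d : measure_display} {T : measurableType d}.
Variable P : probability T R.

(** The lower tail is the upper tail for the complements, which are again independent, with
    parameters [1 - p i]. *)
Lemma chernoff_two_sided n (A : 'I_n -> set T) (p : 'I_n -> R) (e : R) :
  (forall i, measurable (A i)) -> (forall i, 0 <= p i <= 1) ->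
  (forall y, P (pattern A y) = (\prod_(i < n) bernoulli_weight p i (y i))%:E) ->
  0 <= e <= 2 ->
  (P [set w | n%:R * e <= `|\sum_(i < n) (\1_(A i) w - p i)|]%R
     <= (2 * expR (- (e ^+ 2 / 8)) ^+ n)%:E)%E.
Proof.
move=> mA p01 PA e02.
pose A' i := ~` A i; pose p' i := 1 - p i.
have mA' i : measurable (A' i) by exact: measurableC.
have p01' i : 0 <= p' i <= 1 by have := p01 i; rewrite /p'; lra.
have PA' y : P (pattern A' y) = (\prod_(i < n) bernoulli_weight p' i (y i))%:E.
  transitivity (P (pattern A (fun i => ~~ y i))).
    congr (P _); apply/seteqP; split=> w h i; have := h i; last first.
      by rewrite /A' /=; case: (y i) => //= ? ?.
    by rewrite /A' /=; case: (y i) => //= /contrapT.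
  rewrite PA; congr _%:E; apply: eq_bigr => i _.
  by rewrite /bernoulli_weight /p'; case: (y i) => //=; lra.
have sumE w : \sum_(i < n) (\1_(A' i) w - p' i) = - \sum_(i < n) (\1_(A i) w - p i).
  rewrite -sumrN; apply: eq_bigr => i _; rewrite /p' /A' !indicE in_setC.
  by case: (w \in A i) => /=; lra.
set q := expR _; have -> : 2 * q ^+ n = q ^+ n + q ^+ n by rewrite mulr_natl.
pose D (B : 'I_n -> set T) (r : 'I_n -> R) := [set w | n%:R * e <= \sum_(i < n) (\1_(B i) w - r i)].
have mD1 : measurable (D A p) by exact: measurable_deviation.
have mD2 : measurable (D A' p') by exact: measurable_deviation.
have -> : [set w | n%:R * e <= `|\sum_(i < n) (\1_(A i) w - p i)|] = D A p `|` D A' p'.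
  apply/seteqP; split=> w /=; rewrite /D/= sumE ler_normr.
    by move=> /orP[]; [left|right].
  by move=> [->//|->]; rewrite orbT.
apply: le_trans (measureU2 _ _ _) _ => //.
by rewrite EFinD leeD// chernoff_upper.
Qed.

Lemma summable_geometric (q : R) (u : nat -> \bar R) : 0 < q < 1 ->
  (forall n, 0 <= u n)%E -> (forall n, u n <= (2 * q ^+ n)%:E)%E ->
  (\sum_(n <oo) u n < +oo)%E.
Proof.
move=> /andP[q0 q1] u0 uq.
apply: (@le_lt_trans _ _ (2 * (1 - q)^-1)%:E); last exact: ltry.
apply: lime_le; first exact: is_cvg_nneseries.
apply: nearW => n.
apply: (@le_trans _ _ (\sum_(0 <= i < n) (2 * q ^+ i)%:E)%E).
  exact: lee_sum.
rewrite sumEFin lee_fin.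
by apply: geometric_le_lim => //; rewrite ger0_norm// ltW.
Qed.

Lemma strong_law_array (A : forall n, 'I_n -> set T) (p : forall n, 'I_n -> R) :
  (forall n i, measurable (A n i)) -> (forall n i, 0 <= p n i <= 1) ->
  (forall n y, P (pattern (A n) y) =
     (\prod_(i < n) bernoulli_weight (p n) i (y i))%:E) ->
  {ae P, forall w, n%:R^-1 * \sum_(i < n) \1_(A n i) w -
    n%:R^-1 * \sum_(i < n) p n i @[n --> \oo] --> (0 : R)}.
Proof.
move=> mA p01 PA.
pose D (e : R) n := [set w | n%:R * e <= `|\sum_(i < n) (\1_(A n i) w - p n i)|].
have mD e n : measurable (D e n).
  have mS : measurable_fun setT (fun w => `|\sum_(i < n) (\1_(A n i) w - p n i)|).
    apply: measurableT_comp => //.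
    by apply: measurable_sum => i; apply: measurable_funB.
  rewrite -[X in measurable X]setTI.
  have := mS measurableT `[n%:R * e, +oo[%classic (measurable_itv _).
  by congr (measurable _); apply/seteqP; split=> w [_ /=]; rewrite in_itv/= andbT.
have nullD k : P (lim_sup_set (D k.+1%:R^-1)) = 0%E.
  pose e : R := k.+1%:R^-1.
  have e0 : 0 < e by rewrite invr_gt0.
  have e1 : e <= 1 by rewrite invf_le1// ler1n.
  apply: lim_sup_set_cvg0 => //.
  apply: (@summable_geometric (expR (- (e ^+ 2 / 8)))) => [|n|n].
  - rewrite expR_gt0 -expR0 ltr_expR oppr_lt0 divr_gt0//.
    by rewrite exprn_gt0.
  - exact: measure_ge0.
  - by apply: chernoff_two_sided => //; rewrite ltW//= (le_trans e1)// ler1n.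
have mlim k : measurable (lim_sup_set (D k.+1%:R^-1)).
  by apply: bigcapT_measurable => m; exact: bigcup_measurable.
(* Thresholds [1/(k + 1)] suffice, so countably many null sets are discarded. *)
have : {ae P, forall w, forall k, ~ lim_sup_set (D k.+1%:R^-1) w}.
  apply/ae_foralln => k; exists (lim_sup_set (D k.+1%:R^-1)).
  by split; [exact: mlim|exact: nullD|move=> w /= /contrapT].
apply: filterS => w h; apply/cvgrPdist_lt => e e0.
have [k ke] : exists k : nat, k.+1%:R^-1 < e.
  by have [k] := ltr_add_invr e0; rewrite add0r; exists k.
have /existsNP[m /not_implyP[_ hm]] := h k.
(* Starting at [m.+1] rather than [m] keeps [n] positive for the division. *)
exists m.+1 => // n /= mn.
have n0 : 0 < n%:R :> R by rewrite ltr0n (leq_ltn_trans _ mn).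
rewrite sub0r normrN -mulrBr -sumrB normrM ger0_norm ?invr_ge0//.
rewrite mulrC ltr_pdivrMr// ltNge; apply/negP => le_dev; apply: hm.
exists n; first exact: ltnW.
apply: le_trans le_dev; rewrite mulrC ler_wpM2r// ltW//.
Qed.

End StrongLaw.

(** * Observed hazard rates *)

Section IndependentAges.
Context {R : realType} {d : measure_display} {T : measurableType d}.
Variables (P : probability T R) (F0 F : probability (measurableTypeR R) R).
Hypothesis F_age : forall t, df F t = age_df F0 t.
Variables (n : nat) (tau : 'I_n -> int -> T -> R) (l : 'I_n -> R).
Hypothesis l_gt0 : forall i, 0 < l i.
Hypothesis renewal : forall i, stationary_renewal P (tau i) (fun t => df F0 (l i * t)).
Hypothesis indep : independent_processes P tau.

Let age i (w : T) : measurableTypeR R := l i * - tau i 0 w.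

Let mage i : measurable_fun setT (age i).
Proof.
apply: measurable_funM => //; apply: measurableT_comp => //.
by case: (renewal i) => -[].
Qed.

Let ageM i : {mfun T >-> measurableTypeR R} :=
  HB.pack (age i) (@isMeasurableFun.Build _ _ T (measurableTypeR R) (age i) (mage i)).

Let void_age i c :
  {ae P, forall w, void_event (tau i) `]- (c / l i), 0]%classic w <-> c <= age i w}.
Proof.
have := last_point_void (l_gt0 i) (renewal i) (c / l i).
by apply: filterS => w ->; rewrite /age [l i * _]mulrC -ler_pdivrMr// lerNr.
Qed.

Let count_eventE i (B : set R) : count_event (tau i) (fun _ : 'I_1 => B) (fun=> [set 0%E]) =
  void_event (tau i) B.
Proof.
rewrite void_eventE; apply/seteqP; split=> w /=; first by apply; exact: ord0.
by move=> h j.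
Qed.

(** On half-lines the ages are replaced, up to a null set, by void events, whose independence is
    that of the counts with one set per process and value 0. The general case follows from
    [independent_of_rays]. *)
Lemma independent_ages (B : 'I_n -> set (measurableTypeR R)) :
  (forall i, measurable (B i)) ->
  P [set w | forall i, B i (l i * - tau i 0 w)] = (\prod_(i < n) F (B i))%E.
Proof.
move=> mB.
rewrite (@independent_of_rays _ _ _ P n ageM)//.
  apply: eq_bigr => i _.
  exact: (age_law F_age (l_gt0 i) (renewal i)).
move=> c.
have mv i : measurable (void_event (tau i) `]- (c i / l i), 0]%classic).
  exact: (measurable_void (renewal i)).
have mray i : measurable (age i @^-1` `[c i, +oo[%classic).
  by rewrite -[X in measurable X]setTI; exact: mage.
transitivity (P [set w | forall i, void_event (tau i) `]- (c i / l i), 0]%classic w]).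
  apply: eq_measure_ae.
  - rewrite (_ : [set w | _] = [set w | forall i, xpredT i -> `[c i, +oo[%classic (age i w)]).
      by apply: measurable_forall_fin => i _; exact: mray.
    by apply/seteqP; split=> w h i; [move=> _|]; exact: h.
  - rewrite (_ : [set w | _] = [set w | forall i, xpredT i ->
        void_event (tau i) `]- (c i / l i), 0]%classic w]).
      by apply: measurable_forall_fin => i _; exact: mv.
    by apply/seteqP; split=> w h i; [move=> _|]; exact: h.
  have : {ae P, forall w, forall i,
      void_event (tau i) `]- (c i / l i), 0]%classic w <-> c i <= age i w}.
    by apply: filter_forall => i; exact: void_age.
  apply: filterS => w h; split=> h' i; have := h' i; rewrite /= in_itv/= andbT;
  by apply (h i).
have := indep (fun i _ => measurable_itv `]- (c i / l i), 0])
  (fun i (_ : 'I_1) => emeasurable_set1 0%E).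
rewrite (eq_bigr (fun i => P (age i @^-1` `[c i, +oo[%classic))); last first.
  move=> i _; rewrite count_eventE; apply: eq_measure_ae => //.
  by move: (void_age i (c i)); apply: filterS => w; rewrite /= in_itv/= andbT.
move=> <-; congr (P _); apply/seteqP; split=> w h i; have := h i;
by rewrite count_eventE.
Qed.

Variable eta : R -> R.
Hypotheses (m_eta : measurable_fun setT eta) (eta_ge0 : forall a, 0 <= eta a).

Let slow i x : set (measurableTypeR R) := eta @^-1` `[0, x / l i]%classic.

Let mslow i x : measurable (slow i x).
Proof. by rewrite -[X in measurable X]setTI; exact: m_eta. Qed.

Let slowE i x w : slow i x (age i w) <-> observed_hazard eta (l i) (tau i) w <= x.
Proof. by rewrite /slow/= in_itv/= eta_ge0/= ler_pdivlMr// mulrC. Qed.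

Lemma measurable_observed_le i x :
  measurable [set w | observed_hazard eta (l i) (tau i) w <= x].
Proof.
rewrite (_ : [set w | _] = age i @^-1` slow i x); last first.
  by apply/seteqP; split=> w /slowE.
by rewrite -[X in measurable X]setTI; exact: mage.
Qed.

Lemma hazard_df_itv01 x : 0 <= hazard_df F eta x <= 1.
Proof.
have mE : measurable (eta @^-1` `[0, x]%classic : set (measurableTypeR R)).
  by rewrite -[X in measurable X]setTI; exact: m_eta.
by rewrite fine_ge0//= -lee_fin fineK ?fin_num_measure// probability_le1.
Qed.

(** An observed rate at most [x] means an age in [slow i x]. Independence for arbitrary Borel sets
    is what allows [slow i x] or its complement at each coordinate. *)
Lemma observed_pattern x (y : 'I_n -> bool) :
  P (pattern (fun i => [set w | observed_hazard eta (l i) (tau i) w <= x]) y) =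
  (\prod_(i < n) bernoulli_weight (fun i => hazard_df F eta (x / l i)) i (y i))%:E.
Proof.
rewrite (_ : pattern _ _ =
    [set w | forall i, (if y i then slow i x else ~` slow i x) (l i * - tau i 0 w)]).
  rewrite (@independent_ages (fun i => if y i then slow i x else ~` slow i x)) => [|i]; last first.
    by case: (y i) => //; exact: measurableC.
  rewrite -prodEFin; apply: eq_bigr => i _; rewrite /bernoulli_weight.
  have E : F (slow i x) = (hazard_df F eta (x / l i))%:E.
    by rewrite /hazard_df fineK//; apply: fin_num_measure; exact: mslow.
  by case: (y i) => //; rewrite probability_setC// E.
apply/seteqP; split=> w h i; have := h i; case: (y i) => /=.
- by move/slowE.
- by move=> h1 h2; apply: h1; exact/slowE.
- by move/slowE.
- by move=> h1 h2; apply: h1; exact/slowE.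
Qed.

End IndependentAges.

Section ProductSections.
Context {R : realType} {d1 d2 : measure_display}.
Context {T1 : measurableType d1} {T2 : measurableType d2}.
Variables (m1 : probability T1 R) (m2 : probability T2 R).

Lemma product_measure_ysection (E : set (T1 * T2)) : measurable E ->
  ((m1 \x m2) E = \int[m2]_y m1 (ysection E y))%E.
Proof.
move=> mE; rewrite -[LHS]/(product_measure1 m1 m2 E).
have := @indic_fubini_tonelli _ _ T1 T2 R m1 m2 E mE.
by rewrite indic_fubini_tonelli_FE// indic_fubini_tonelli_GE.
Qed.

End ProductSections.

(** * The limiting law and the convergence of the mean *)

Section Mixture.
Context {R : realType}.
Variables (F L : probability (measurableTypeR R) R) (eta : R -> R).
Hypotheses (m_eta : measurable_fun setT eta) (eta_ge0 : forall a, 0 <= eta a).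
Hypothesis L_le0 : L `]-oo, 0]%classic = 0%E.

Let scaled (z : measurableTypeR R * measurableTypeR R) : measurableTypeR R :=
  z.1 * eta z.2.

Let m_scaled : measurable_fun setT scaled.
Proof.
apply: measurable_funM; first exact: measurable_fst.
by apply: measurableT_comp => //; exact: measurable_snd.
Qed.

#[local] HB.instance Definition _ :=
  @isMeasurableFun.Build _ _ _ (measurableTypeR R) scaled m_scaled.

Let scaledM : {mfun (measurableTypeR R * measurableTypeR R)%type >-> measurableTypeR R} :=
  scaled.

(** The law of [l * eta a] for independent [l] and [a] of laws [L] and [F]. Having it as a measure
    makes its atoms available. *)
Definition mixture : probability (measurableTypeR R) R :=
  distribution (L \x F)%E scaledM.

Let m_preimage (B : set (measurableTypeR R)) : measurable B -> measurable (scaled @^-1` B).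
Proof. by move=> mB; rewrite -[X in measurable X]setTI; exact: m_scaled. Qed.

Lemma mixtureE (B : set (measurableTypeR R)) : measurable B ->
  mixture B = (\int[F]_a L [set l | B (l * eta a)%R])%E.
Proof.
move=> mB; transitivity ((L \x F)%E (scaled @^-1` B)) => //.
rewrite product_measure_ysection; last exact: m_preimage.
apply: eq_integral => a _; congr (L _).
by apply/seteqP; split=> l; rewrite /ysection/= inE.
Qed.

Lemma measurable_mixture_section (B : set (measurableTypeR R)) : measurable B ->
  measurable_fun setT (fun a : measurableTypeR R => L [set l | B (l * eta a)]).
Proof.
move=> mB; have := measurable_fun_ysection L (m_preimage mB).
apply: eq_measurable_fun => a _ /=; congr (L _).
by apply/seteqP; split=> l; rewrite /ysection/= inE.
Qed.

Let mslow y : measurable (eta @^-1` `[0, y]%classic : set (measurableTypeR R)).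
Proof. by rewrite -[X in measurable X]setTI; exact: m_eta. Qed.

(** The product measure is computed by integrating over [l] last. The half-line [l <= 0] is
    [L]-null, and for positive [l] the section is the set defining [hazard_df] at [x / l]. *)
Lemma df_mixture (x : R) : df mixture x = mixture_df (hazard_df F eta) L x.
Proof.
rewrite /df /mixture_df /Rintegral; congr fine.
transitivity (\int[L]_l F (xsection (scaled @^-1` `]-oo, x]%classic) l))%E => //.
have mxs : measurable_fun setT (fun l => F (xsection (scaled @^-1` `]-oo, x]%classic) l)).
  by apply: measurable_fun_xsection; exact: m_preimage.
have mN : measurable (`]-oo, 0]%classic : set (measurableTypeR R)) by [].
rewrite (ge0_negligible_integral mN measurableT mxs (fun _ _ => measure_ge0 _ _) L_le0).
rewrite setTD setCitvl.
apply: eq_integral => l; rewrite inE/= in_itv/= andbT => l0.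
rewrite /hazard_df fineK; last by apply: fin_num_measure; exact: mslow.
congr (F _); apply/seteqP; split=> a; rewrite /xsection/= inE/= !in_itv/= eta_ge0/=.
  by rewrite ler_pdivlMr// mulrC.
by rewrite ler_pdivlMr// mulrC.
Qed.

Variable lam : forall n, 'I_n -> R.
Hypothesis lam_gt0 : forall n i, 0 < @lam n i.
Hypothesis lam_cvg : forall y, {for y, continuous (df L)} ->
  empirical_df (@lam n) y @[n --> \oo] --> df L y.

Lemma mean_hazard_df_cvg (x : R) : mixture [set x] = 0%E ->
  n%:R^-1 * \sum_(i < n) hazard_df F eta (x / lam i) @[n --> \oo] --> df mixture x.
Proof.
move=> x0.
(* Exchanging the finite sum with the integral over [a] turns the mean of [f_ n] into the average in
   the statement; convergence is then dominated by 1. *)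
pose f_ n (a : measurableTypeR R) : \bar R := (empirical_df (fun i : 'I_n => lam i * eta a) x)%:E.
pose f (a : measurableTypeR R) : \bar R := L [set l | `]-oo, x]%classic (l * eta a)].
have mterm n (i : 'I_n) : measurable [set a : measurableTypeR R | lam i * eta a <= x].
  rewrite (_ : [set a | _] = eta @^-1` `[0, x / lam i]%classic).
    exact: mslow.
  by apply/seteqP; split=> a /=; rewrite in_itv/= eta_ge0/= ler_pdivlMr// mulrC.
have f_E n a : f_ n a = (n%:R^-1 * \sum_(i < n)
    \1_[set a : measurableTypeR R | lam i * eta a <= x] a)%:E.
  rewrite /f_ /empirical_df; congr (_ * _)%:E; apply: eq_bigr => i _.
  by rewrite indicE mem_setE.
have mf_ n : measurable_fun [set: measurableTypeR R] (f_ n).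
  apply: (eq_measurable_fun _ (fun a _ => esym (f_E n a))).
  apply/measurable_EFinP/measurable_funM => //.
  by apply: measurable_sum => i; apply: measurable_indic; exact: mterm.
have int_f n : (\int[F]_a f_ n a =
    (n%:R^-1 * \sum_(i < n) hazard_df F eta (x / lam i))%:E)%E.
  rewrite (eq_integral (fun a => (n%:R^-1)%:E * \sum_(i < n)
      (\1_[set a : measurableTypeR R | lam i * eta a <= x] a)%:E)%E); last first.
    by move=> a _; rewrite f_E EFinM sumEFin.
  rewrite ge0_integralZl//; last 2 first.
  - by apply: emeasurable_sum => i; apply/measurable_EFinP; apply: measurable_indic; exact: mterm.
  - by move=> a _; apply: sume_ge0 => i _; rewrite lee_fin.
  rewrite ge0_integral_sum//; last first.
    by move=> i; apply/measurable_EFinP; apply: measurable_indic; exact: mterm.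
  rewrite EFinM -sumEFin; congr (_ * _)%E; apply: eq_bigr => i _.
  rewrite integral_indic// setIT /hazard_df fineK; last by apply: fin_num_measure; exact: mslow.
  congr (F _); apply/seteqP; split=> a /=; rewrite in_itv/= eta_ge0/=;
  by rewrite ler_pdivlMr// mulrC.
have mf : measurable_fun [set: measurableTypeR R] f by exact: measurable_mixture_section.
(* An atomless [x] for the mixture means that, for almost every [a] with [eta a] positive,
   [x / eta a] is a continuity point of [df L]. *)
have ae_x : {ae F, forall a : measurableTypeR R, L [set l | l * eta a = x] = 0%E}.
  have : (\int[F]_a `|L [set l | [set x] (l * eta a)%R]| = 0)%E.
    by rewrite -[RHS]x0 mixtureE//; apply: eq_integral => a _; rewrite gee0_abs.
  move/(ae_eq_integral_abs F measurableT (measurable_mixture_section (measurable_set1 x))).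
  by apply: filterS => a /(_ I).
have f_f : {ae F, forall a : measurableTypeR R,
    [set: measurableTypeR R] a -> f_ ^~ a @ \oo --> f a}.
  case: ae_x => N [mN N0 subN]; exists N; split=> // a na; apply: subN => /= La.
  apply: na => _; rewrite /f_ /f.
  (* When [eta a = 0], the limit is the indicator of [0 <= x], and so is every term with [n]
     positive; the empty average at [n = 0] is 0. *)
  have [ea|ea] := eqVneq (eta a) 0.
    have -> : [set l | `]-oo, x]%classic (l * eta a)] = [set _ | 0 <= x].
      by apply/seteqP; split=> l /=; rewrite in_itv/= ea mulr0.
    apply: (@cvg_near_cst _ _ _ _ _); near=> n.
    have n0 : (0 < n)%N by near: n; exact: nbhs_infty_gt.
    rewrite /empirical_df; under eq_bigr do rewrite ea mulr0.
    rewrite sumr_const card_ord -[X in _ * X]mulr_natl mulrA mulVf ?mul1r ?pnatr_eq0 -?lt0n//.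
    case: (0 <= x) => /=.
      by rewrite (_ : [set _ | true] = setT) ?probability_setT//; apply/seteqP; split.
    by rewrite (_ : [set _ | false] = set0) ?measure0//; apply/seteqP; split.
  have ea0 : 0 < eta a by rewrite lt_neqAle eq_sym ea eta_ge0.
  have -> : [set l | `]-oo, x]%classic (l * eta a)] = `]-oo, x / eta a]%classic.
    by apply/seteqP; split=> l /=; rewrite !in_itv/= ler_pdivlMr.
  rewrite -df_EFin; apply: cvg_EFin; first by near=> n.
  have -> : (fine \o (fun n => (empirical_df (fun i : 'I_n => lam i * eta a) x)%:E)) =
      (fun n => empirical_df (@lam n) (x / eta a)).
    apply/funext => n /=; rewrite /empirical_df; congr (_ * _).
    by apply: eq_bigr => i _; rewrite ler_pdivlMr.
  apply: lam_cvg; apply/df_continuousP; rewrite -[RHS]La; congr (L _).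
  apply/seteqP; split=> l /= => [->|<-]; first by rewrite divfK.
  by rewrite mulfK.
have g1 : F.-integrable [set: measurableTypeR R] (cst 1%E : measurableTypeR R -> \bar R).
  exact: (finite_measure_integrable_cst F 1 measurableT).
have f_g : {ae F, forall (a : measurableTypeR R) n,
    [set: measurableTypeR R] a -> (`|f_ n a| <= 1)%E}.
  apply: aeW => a n _; rewrite f_E abse_EFin lee_fin ger0_norm; last first.
    by rewrite mulr_ge0// sumr_ge0.
  have [->|n0] := posnP n; first by rewrite big_ord0 mulr0.
  rewrite mulrC ler_pdivrMr ?ltr0n// mul1r.
  apply: (@le_trans _ _ (\sum_(i < n) 1)); last by rewrite sumr_const card_ord.
  by apply: ler_sum => i _; rewrite indicE; case: (_ \in _).
have [_ _] := @dominated_convergence _ (measurableTypeR R) R F setT measurableT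
  f_ f _ mf_ mf f_f g1 f_g.
rewrite -mixtureE// -df_EFin => /fine_cvg.
by apply: cvg_trans; apply: near_eq_cvg; near=> n; rewrite /= int_f.
Unshelve. all: by end_near. Qed.

End Mixture.

(** * Convergence on a dense set *)

Section ContinuityPoints.
Context {R : realType} (mu : probability (measurableTypeR R) R).

Let idR : measurableTypeR R -> R := idfun.

#[local] HB.instance Definition _ :=
  @isMeasurableFun.Build _ _ _ _ idR (@measurable_id _ _ setT).

(** Atoms are countable, whereas the interval has positive Lebesgue measure. *)
Lemma atomless_between (a b : R) : a < b -> exists2 c, a < c < b & mu [set c] = 0%E.
Proof.
move=> ab; apply: contrapT => /forall2NP atoms.
have : countable `]a, b[%classic.
  apply: sub_countable (@pmf_gt0_countable _ _ _ mu idR).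
  apply: subset_card_le => c /=; rewrite in_itv/= => acb.
  have [//|c0] := atoms c.
  rewrite /pmf lt_neqAle fine_ge0// andbT eq_sym; apply/eqP => f0; apply: c0.
  by rewrite -[LHS]fineK ?fin_num_measure// -[X in fine X]/(mu (idR @^-1` [set c])) f0.
move/countable_lebesgue_measure0; rewrite lebesgue_measure_itv/= lte_fin ab => /eqP.
by rewrite -EFinB eqe subr_eq0 gt_eqF.
Qed.

Lemma dense_atomless_sequence : exists g : nat -> R,
  (forall k, mu [set g k] = 0%E) /\ (forall a b, a < b -> exists k, a < g k < b).
Proof.
(* One point is taken between each coded pair of rationals [p < q]; other codes receive an arbitrary
   atomless point of the unit interval. *)
have /choice[g gP] : forall k : nat, exists c : R, mu [set c] = 0%E /\
    (forall p q : rat, unpickle k = Some (p, q) -> p < q -> ratr p < c < ratr q).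
  move=> k; case E : (unpickle k : option (rat * rat)) => [[p q]|]; last first.
    by have [c _ c0] := @atomless_between 0 1 ltr01; exists c.
  have [pq|pq] := ltP p q; last first.
    have [c _ c0] := @atomless_between 0 1 ltr01; exists c; split=> // p' q' [<- <-].
    by rewrite ltNge pq.
  have [c pcq c0] := @atomless_between (ratr p) (ratr q) ltac:(by rewrite ltr_rat).
  by exists c; split=> // p' q' [<- <-].
exists g; split=> [k|a b ab]; first by have [] := gP k.
have [p] := rat_in_itvoo ab; rewrite in_itv/= => /andP[ap pb].
have [q] := rat_in_itvoo pb; rewrite in_itv/= => /andP[pq qb].
exists (pickle (p, q)); have [_ /(_ p q)] := gP (pickle (p, q)).
rewrite pickleK -(ltr_rat R) => /(_ erefl pq) /andP[h1 h2].
by rewrite (lt_trans ap h1) (lt_trans h2 qb).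
Qed.

End ContinuityPoints.

Section DenseConvergence.
Context {R : realType} (H_ : nat -> R -> R) (H : R -> R).
Hypothesis H_nd : forall n, {homo H_ n : x y / x <= y}.
Hypothesis H_dense : forall a b, a < b ->
  exists2 c, a < c < b & H_ n c @[n --> \oo] --> H c.

Lemma cvg_continuity_point x : {for x, continuous H} -> H_ n x @[n --> \oo] --> H x.
Proof.
move=> Hx; apply/cvgrPdist_lt => e e0.
have e2 : 0 < e / 2 by rewrite divr_gt0.
have /cvgrPdist_lt/(_ _ e2)[r /= r0 rP] := Hx.
have [c1 /andP[xc1 c1x] /cvgrPdist_lt/(_ _ e2) H1] : exists2 c, x - r < c < x &
    H_ n c @[n --> \oo] --> H c by apply: H_dense; rewrite ltrBlDr ltrDl.
have [c2 /andP[xc2 c2x] /cvgrPdist_lt/(_ _ e2) H2] : exists2 c, x < c < x + r &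
    H_ n c @[n --> \oo] --> H c by apply: H_dense; rewrite ltrDl.
have := rP c1; rewrite /ball/= gtr0_norm ?subr_gt0// ltrBlDl -ltrBlDr => /(_ xc1).
have := rP c2; rewrite /ball/= distrC gtr0_norm ?subr_gt0// ltrBlDl => /(_ c2x).
move=> h2 h1; near=> n.
have n1 : H_ n c1 <= H_ n x by rewrite H_nd// ltW.
have n2 : H_ n x <= H_ n c2 by rewrite H_nd// ltW.
have : `|H c1 - H_ n c1| < e / 2 by near: n.
have : `|H c2 - H_ n c2| < e / 2 by near: n.
move: h1 h2; rewrite !ltr_norml => /andP[? ?] /andP[? ?] /andP[? ?] /andP[? ?].
by apply/andP; split; lra.
Unshelve. all: by end_near. Qed.

Hypothesis H_df : is_df H.

Lemma quantile_ge0 (F : R -> R) p : (0 <= quantile F p)%E.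
Proof. by apply: le_ereal_inf_tmp => _ [x [x0 _] <-]; rewrite lee_fin. Qed.

Lemma quantile_le (F : R -> R) p x : 0 <= x -> p <= F x -> (quantile F p <= x%:E)%E.
Proof. by move=> x0 px; apply: ereal_inf_lbound; exists x. Qed.

Lemma quantile_ge (F : R -> R) p x : {homo F : x y / x <= y} -> F x < p ->
  (x%:E <= quantile F p)%E.
Proof.
move=> F_nd Fxp; apply: le_ereal_inf_tmp => _ [y [y0 py] <-]; rewrite lee_fin.
by rewrite leNgt; apply/negP => /ltW /F_nd; rewrite leNgt (lt_le_trans Fxp).
Qed.

Lemma quantile_cvg (p_ : nat -> R) (p : R) : 0 <= p < 1 ->
  p_ n @[n --> \oo] --> p ->
  quantile H q @[q --> within `[0, 1] (nbhs p)] --> quantile H p ->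
  quantile (H_ n) (p_ n) @[n --> \oo] --> quantile H p.
Proof.
move=> /andP[p0 p1] p_p Qp.
have [H_mono _ _ Hy1] := H_df.
have [y0 y00 py0] : exists2 y, 0 <= y & p <= H y.
  have e0 : 0 < 1 - p by rewrite subr_gt0.
  have /cvgrPdist_lt/(_ _ e0) := Hy1; move=> /(filterI (nbhs_pinfty_ge (num_real 0))).
  move=> /filter_ex[y [/= y0 h]]; exists y => //.
  by have := le_lt_trans (ler_norm _) h; lra.
have Qfin : quantile H p \is a fin_num.
  by rewrite ge0_fin_numE ?quantile_ge0// (le_lt_trans (quantile_le y00 py0))// ltry.
pose th := fine (quantile H p).
have thE : quantile H p = th%:E by rewrite fineK.
have th0 : 0 <= th by rewrite -lee_fin -thE quantile_ge0.
have near_lt (u v : nat -> R) a b : a < b -> u n @[n --> \oo] --> a ->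
    v n @[n --> \oo] --> b -> \forall n \near \oo, u n < v n.
  move=> ab ua vb; have am : a < (a + b) / 2 by lra.
  have mb : (a + b) / 2 < b by lra.
  near=> n; apply: (@lt_trans _ _ ((a + b) / 2)); near: n.
    exact: (cvgr_lt _ ua).
  exact: (cvgr_gt _ vb).
have upper y : th < y -> \forall n \near \oo, (quantile (H_ n) (p_ n) <= y%:E)%E.
  move=> thy; have [c /andP[thc cy] Hc] := H_dense thy.
  (* Otherwise [H] would stay at most [p] up to [c], and quantiles at levels just above [p] would be
     at least [c], contradicting continuity of the quantile function at [p]. *)
  have Hcp : p < H c.
    rewrite ltNge; apply/negP => Hcp.
    have : \forall q \near within `[0, 1] (nbhs p), (quantile H q < c%:E)%E.
      by apply: (Qp [set z | (z < c%:E)%E]); apply: open_ereal_lt'; rewrite thE lte_fin.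
    rewrite near_withinE => -[r /= r0 rP].
    (* The cap at 1 keeps the level in [[0, 1]], where continuity is assumed; [p < 1] leaves room
       above [p]. *)
    pose q := Num.min 1 (p + r / 2).
    have pq : p < q by rewrite lt_min p1 ltrDl divr_gt0.
    have q1 : q <= 1 by rewrite ge_min lexx.
    have qr : q <= p + r / 2 by rewrite ge_min lexx orbT.
    have : (quantile H q < c%:E)%E.
      apply: rP => /=; last by rewrite in_itv/= q1 andbT (le_trans p0)// ltW.
      by rewrite /ball/= distrC gtr0_norm ?subr_gt0//; lra.
    by rewrite ltNge (quantile_ge H_mono (le_lt_trans Hcp pq)).
  have : \forall n \near \oo, p_ n < H_ n c.
    exact: (near_lt p_ (H_ ^~ c) _ _ Hcp p_p Hc).
  apply: filterS => n /ltW pn; apply: le_trans (quantile_le _ pn) _.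
    by rewrite (le_trans th0)// ltW.
  by rewrite lee_fin ltW.
have lower y : y < th -> \forall n \near \oo, (y%:E <= quantile (H_ n) (p_ n))%E.
  (* Quantiles are infima over nonnegative numbers, so a negative bound is immediate; for [y >= 0]
     the definition of the infimum gives [H c < p] at a point [c] between [y] and [th]. *)
  move=> yth; have [y_lt0|y_ge0] := ltP y 0.
    by apply: nearW => n; rewrite (le_trans _ (quantile_ge0 _ _))// lee_fin ltW.
  have [c /andP[yc cth] Hc] := H_dense yth.
  have Hcp : H c < p.
    rewrite ltNge; apply/negP => /(quantile_le (le_trans y_ge0 (ltW yc))).
    by rewrite thE lee_fin leNgt cth.
  have : \forall n \near \oo, H_ n c < p_ n.
    exact: (near_lt (H_ ^~ c) p_ _ _ Hcp Hc p_p).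
  apply: filterS => n /(quantile_ge (@H_nd n)); apply: le_trans.
  by rewrite lee_fin ltW.
rewrite thE; apply/fine_cvgP; split.
  near=> n.
  have h1 : ((th - 1)%:E <= quantile (H_ n) (p_ n))%E.
    by near: n; apply: lower; rewrite ltrBlDr ltrDl.
  have h2 : (quantile (H_ n) (p_ n) <= (th + 1)%:E)%E.
    by near: n; apply: upper; rewrite ltrDl.
  by rewrite ge0_fin_numE ?quantile_ge0// (le_lt_trans h2)// ltry.
apply/cvgrPdist_le => e e0; near=> n.
have h1 : ((th - e)%:E <= quantile (H_ n) (p_ n))%E.
  by near: n; apply: lower; rewrite ltrBlDr ltrDl.
have h2 : (quantile (H_ n) (p_ n) <= (th + e)%:E)%E.
  by near: n; apply: upper; rewrite ltrDl.
have h3 : quantile (H_ n) (p_ n) \is a fin_num.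
  by rewrite ge0_fin_numE ?quantile_ge0// (le_lt_trans h2)// ltry.
move: h1 h2; rewrite -[quantile _ _]fineK// !lee_fin => h1 h2 /=.
by rewrite ler_norml; lra.
Unshelve. all: by end_near. Qed.

End DenseConvergence.

(** * Properties of the hazard rate and conclusion *)

Section Hazard.
Context {R : realType} (F0 : probability (measurableTypeR R) R) (f0 : R -> R).

Lemma hazard_ge0 : (forall t, 0 <= f0 t) -> forall t, 0 <= hazard F0 f0 t.
Proof. by move=> f00 t; rewrite divr_ge0// subr_ge0 df_le1. Qed.

Lemma measurable_hazard : measurable_fun setT f0 -> measurable_fun setT (hazard F0 f0).
Proof.
move=> mf0; apply: measurable_funM => //.
have m1 : measurable_fun [set: R] (fun t => 1 - df F0 t).
  by apply: measurable_funB => //; apply: nondecreasing_measurable => //; exact: df_nd.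
(* The inverse is rewritten as a real power, a measurable function; the two agree on nonnegative
   numbers, including 0. *)
apply: (@eq_measurable_fun _ _ _ _ _ (fun t => (1 - df F0 t) `^ (-1))).
  by move=> t _; rewrite powR_inv1// subr_ge0 df_le1.
exact: (measurableT_comp (measurable_powR _) m1).
Qed.

End Hazard.

Unset Implicit Arguments.

Theorem theorem2 (R : realType) (d : measure_display) (T : measurableType d)
  (P : probability T R)
  (F0 : probability (measurableTypeR R) R) (f0 : R -> R)
  (f0_meas : measurable_fun setT f0)
  (f0_ge0 : forall t, 0 <= f0 t)
  (F0_pos : F0 `]-oo, 0[%classic = 0%E)
  (F0_density : forall A : set R, measurable A ->
     F0 A = (\int[lebesgue_measure]_(t in A) (f0 t)%:E)%E)
  (F0_mean : (\int[F0]_t t%:E = 1)%E)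
  (F : probability (measurableTypeR R) R)
  (F_age : forall t, df F t = age_df F0 t)
  (lambda : forall N : nat, 'I_N -> R)
  (lambda_pos : forall N (i : 'I_N), 0 < lambda N i)
  (lambda_noninc : forall N (i j : 'I_N), (i <= j)%N -> lambda N j <= lambda N i)
  (L : probability (measurableTypeR R) R)
  (L_no_atom : L [set 0] = 0%E)
  (lambda_cvg : weak_cvg (fun N => empirical_df (lambda N)) (df L))
  (Phi : forall N : nat, 'I_N -> int -> T -> R)
  (Phi_renewal : forall N (i : 'I_N),
     stationary_renewal P (Phi N i) (fun t => df F0 (lambda N i * t)))
  (Phi_indep : forall N, independent_processes P (Phi N)) :
  let eta := hazard F0 f0 in
  let G := hazard_df F eta in
  let Ginf := mixture_df G L in
  let X N (i : 'I_N) w := observed_hazard eta (lambda N i) (Phi N i) w in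
  let Ghat N w := empirical_df (fun i : 'I_N => X N i w) in
  {ae P, forall w, weak_cvg (fun N => Ghat N w) Ginf} /\
  forall (C : nat -> nat) (c : R),
    (forall N, (1 < N)%N -> (1 <= C N < N)%N) ->
    (C N)%:R / N%:R @[N --> \oo] --> c ->
    0 < c <= 1 ->
    quantile Ginf p @[p --> within `[0, 1] (nbhs (1 - c))]
      --> quantile Ginf (1 - c) ->
    {ae P, forall w,
      quantile (Ghat N w) (1 - (C N)%:R / N%:R) @[N --> \oo]
        --> quantile Ginf (1 - c)}.
Proof.
move=> eta G Ginf X Ghat.
have m_eta : measurable_fun setT eta by exact: measurable_hazard.
have eta_ge0 a : 0 <= eta a by exact: hazard_ge0.
have [_ lambda_L] := lambda_cvg.
(* The absence of an atom makes 0 a continuity point of [df L], and the empirical distribution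
   functions vanish there because all rates are positive. *)
have L_le0 : L `]-oo, 0]%classic = 0%E.
  have /lambda_L L0 : {for 0, continuous (df L)} by exact/df_continuousP.
  rewrite -df_EFin; congr _%:E; apply/esym; apply: (cvg_unique _ _ L0) => //.
  rewrite (_ : (fun N => _) = fun=> 0); first exact: cvg_cst.
  apply/funext => N; rewrite /empirical_df big1 ?mulr0// => i _.
  by rewrite leNgt lambda_pos.
have GinfE : Ginf = df (mixture F L m_eta) by apply/funext => x; rewrite df_mixture.
have Ginf_df : is_df Ginf by rewrite GinfE; exact: df_is_df.
have Ghat_nd w N : {homo Ghat N w : x y / x <= y}.
  move=> x y xy; rewrite ler_wpM2l ?invr_ge0//; apply: ler_sum => i _.
  by rewrite ler_nat; case: (leP (X N i w) x) => // /le_trans ->.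
have [g [g0 g_dense]] := dense_atomless_sequence (mixture F L m_eta).
(* The sequence [g] is countable and deterministic, so one null set serves all its points; the same
   almost sure event yields both conclusions. *)
have Ghat_g : {ae P, forall w, forall k, Ghat N w (g k) @[N --> \oo] --> Ginf (g k)}.
  apply/ae_foralln => k.
  have mean := mean_hazard_df_cvg eta_ge0 lambda_pos lambda_L (g0 k).
  have : {ae P, forall w,
      N%:R^-1 * (\sum_(i < N) \1_[set w | X N i w <= g k] w) -
      N%:R^-1 * (\sum_(i < N) G (g k / lambda N i)) @[N --> \oo] --> (0 : R)}.
    apply: (@strong_law_array _ _ _ _ (fun N i => [set w | X N i w <= g k])
      (fun N i => G (g k / lambda N i))) => [N i|N i|N y].
    - exact: (measurable_observed_le (lambda_pos N) (Phi_renewal N)).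
    - exact: hazard_df_itv01.
    - exact: (observed_pattern F_age (lambda_pos N) (Phi_renewal N) (Phi_indep N)).
  apply: filterS => w dev; rewrite GinfE -[X in _ --> X]add0r.
  apply: (cvg_trans _ (cvgD dev mean)); apply: near_eq_cvg; near=> N.
  rewrite /= subrK /Ghat /empirical_df; congr (_ * _); apply: eq_bigr => i _.
  by rewrite indicE mem_setE.
have Ghat_dense w : (forall k, Ghat N w (g k) @[N --> \oo] --> Ginf (g k)) ->
    forall a b, a < b -> exists2 c, a < c < b & Ghat N w c @[N --> \oo] --> Ginf c.
  by move=> h a b ab; have [k kab] := g_dense a b ab; exists (g k).
split=> [|C c C_lt Cc /andP[c0 c1] Qc]; apply: filterS Ghat_g => w /Ghat_dense dense.
  split=> // x; exact: (cvg_continuity_point (Ghat_nd w) dense).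
apply: (quantile_cvg (Ghat_nd w) dense Ginf_df) => //.
  by rewrite subr_ge0 c1 ltrBlDr ltrDl.
by apply: cvgB => //; exact: cvg_cst.
Unshelve. all: by end_near. Qed.
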